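(* Let $F$ be a number field and $n\in\mathbb{N}$. A non-archimedean squareclass $S\in\mathrm{SqCl}(\mathbb{A}_{F,\mathbf{f}}^\times,U_\mathbf{f})$ is the Hessian determinant squareclass $\det_H(L)$ of some non-degenerate rank $n$ (possibly not $\mathcal{O}_F$-valued) quadratic $\mathcal{O}_F$-lattice $L$ if and only if $S$ is globally rational.
   Context: $\mathrm{SqCl}(\mathbb{A}_{F,\mathbf{f}}^\times,U_\mathbf{f}):=\mathbb{A}_{F,\mathbf{f}}^\times/U_\mathbf{f}^2$, where $\mathbb{A}_{F,\mathbf{f}}^\times$ is the group of finite ideles of $F$ and $U_\mathbf{f}=\prod_\mathfrak{p}\mathcal{O}_\mathfrak{p}^\times$; write $S_\mathfrak{p}\in F_\mathfrak{p}^\times/(\mathcal{O}_\mathfrak{p}^\times)^2$ for the component of $S$ at $\mathfrak{p}$. $S$ is globally rational if its image in $\mathbb{A}_{F,\mathbf{f}}^\times/(\mathbb{A}_{F,\mathbf{f}}^\times)^2$ lies in the image of $F^\times/(F^\times)^2$ under the diagonal map, i.e. there is $\alpha\in F^\times$ with $S_\mathfrak{p}\subseteq\alpha(F_\mathfrak{p}^\times)^2$ for all primes $\mathfrak{p}$. A rank $n$ quadratic $\mathcal{O}_F$-lattice is a finitely generated $\mathcal{O}_F$-submodule $L$ of an $n$-dimensional quadratic space $(V,Q)$ over $F$ with $L\otimes_{\mathcal{O}_F}F=V$; it is non-degenerate if $Q$ is. Its Hessian determinant squareclass $\det_H(L)$ is the element of $\mathrm{SqCl}(\mathbb{A}_{F,\mathbf{f}}^\times,U_\mathbf{f})$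 whose component at $\mathfrak{p}$ is the class of the determinant of the Hessian matrix $(\partial^2Q_\mathfrak{p}/\partial x_i\partial x_j)$ of the form $Q_\mathfrak{p}$ obtained from $Q$ on $L_\mathfrak{p}=L\otimes\mathcal{O}_\mathfrak{p}$ using any $\mathcal{O}_\mathfrak{p}$-basis of $L_\mathfrak{p}$. *)

(* Defs.v *)
From HB Require Import structures.
From mathcomp Require Import all_boot all_order all_algebra all_field.
From mathcomp Require Import boolp classical_sets functions cardinality.
From mathcomp Require Import mpoly.

Set Implicit Arguments.
Unset Strict Implicit.
Unset Printing Implicit Defensive.

Import GRing.Theory Num.Theory.
Local Open Scope classical_set_scope.
Local Open Scope ring_scope.

(* A number field is an inhabitant of [fieldExtType rat], i.e. a finite
   extension of the rationals. *)

Definition OF (F : fieldExtType rat) : set F :=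
  [set x | integralOver (intr : int -> F) x].

Record prime_ideal (F : fieldExtType rat) := PrimeIdeal {
  prime_set : set F;
  prime_sub : prime_set `<=` @OF F;
  primeD : forall x y, prime_set x -> prime_set y -> prime_set (x + y);
  primeM : forall a x, OF a -> prime_set x -> prime_set (a * x);
  prime1 : ~ prime_set 1;
  prime_mul : forall x y, OF x -> OF y -> prime_set (x * y) ->
    prime_set x \/ prime_set y;
  prime_nz : exists2 x, prime_set x & x != 0 }.

Section Localization.
Variables (F : fieldExtType rat) (p : prime_ideal F).

Definition Oloc : set F :=
  [set x | exists a s, [/\ OF a, OF s, ~ prime_set p s & x = a / s]].

Lemma OF_nat n : OF (n%:R : F).
Proof. exact: integral_nat. Qed.

Lemma int_eq0 (z : int) : ((z%:~R : F) == 0) = (z == 0).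
Proof.
rewrite -(rmorph_int (in_alg F)) /= scaler_eq0 intr_eq0.
by rewrite oner_eq0 orbF.
Qed.

Lemma OF_clear (x : F) : exists d : F, [/\ OF d, d != 0 & OF (d * x)].
Proof.
have /polyOver1P[q0 Dq0] := minPolyOver 1%AS x.
have [q [a nz_a Dq]] := rat_poly_scale q0.
have rq : root (map_poly (intr : int -> F) q) x.
  have := root_minPoly 1%AS x.
  rewrite Dq0 Dq linearZ /= rootZ; last first.
    by rewrite scaler_eq0 invr_eq0 intr_eq0 oner_eq0 orbF.
  rewrite -map_poly_comp; congr (root _ x).
  apply: eq_map_poly => z /=.
  by rewrite -(rmorph_int (in_alg F)).
have nz_q : q != 0.
  apply/eqP=> q0E; move: (monic_neq0 (monic_minPoly 1%AS x)).
  by rewrite Dq0 Dq q0E map_poly0 scaler0 map_poly0 eqxx.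
have sz_q : size q = (size q).-1.+1 by rewrite prednK // size_poly_gt0.
set n := (size q).-1 in sz_q; set c := lead_coef q.
have nz_c : c != 0 by rewrite lead_coef_eq0.
have n_gt0 : (0 < n)%N.
  rewrite lt0n; apply/eqP=> n0.
  have q1 : size q = 1%N by rewrite sz_q n0.
  move: rq; rewrite (size1_polyC (eq_leq q1)) map_polyC /= rootC int_eq0.
  by move: nz_c; rewrite /c /lead_coef q1 => /negPf->.
exists (c%:~R); split; first exact: integral_id.
  by rewrite int_eq0.
exists ('X^n + \poly_(i < n) (q`_i * c ^+ (n.-1 - i))).
  rewrite monicE lead_coefDl ?lead_coefXn // size_polyXn.
  by rewrite ltnS size_poly.
rewrite rmorphD /= map_polyXn rootE hornerD hornerXn.
have -> : map_poly intr (\poly_(i < n) (q`_i * c ^+ (n.-1 - i))) =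
          \poly_(i < n) ((q`_i * c ^+ (n.-1 - i))%:~R : F).
  apply/polyP=> i; rewrite coef_map /= !coef_poly.
  by case: ifP => //; rewrite ?rmorph0.
rewrite horner_poly.
have -> : \sum_(i < n) (q`_i * c ^+ (n.-1 - i))%:~R * (c%:~R * x) ^+ i =
   (c%:~R ^+ n.-1) * \sum_(i < n) (q`_i)%:~R * x ^+ i.
  rewrite mulr_sumr; apply: eq_bigr => i _.
  rewrite exprMn rmorphM rmorphXn /=.
  have lein : (i <= n.-1)%N by rewrite -ltnS prednK.
  rewrite -[X in _ = _ ^+ X * _](subnK lein) exprD.
  by rewrite [X in X * _ = _]mulrC mulrACA.
have szq : (size (map_poly (intr : int -> F) q) <= n.+1)%N.
  by rewrite -sz_q size_poly.
move: rq; rewrite rootE (horner_coef_wide _ szq).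
rewrite big_ord_recr /= => /eqP rq.
suff -> : (c%:~R * x) ^+ n =
    c%:~R ^+ n.-1 * ((map_poly (intr : int -> F) q)`_n * x ^+ n).
  have -> : \sum_(i < n) (q`_i)%:~R * x ^+ i =
      \sum_(i < n) (map_poly (intr : int -> F) q)`_i * x ^+ i.
    by apply: eq_bigr => i _; rewrite coef_map.
  by rewrite -mulrDr addrC rq mulr0.
rewrite coef_map /= exprMn mulrA; congr (_ * _).
by rewrite -exprSr prednK.
Qed.


Lemma prime_set0 : prime_set p 0.
Proof.
have [x px _] := prime_nz p.
by rewrite -(mul0r x); apply: primeM px; apply: (OF_nat 0).
Qed.

Lemma notp_neq0 s : ~ prime_set p s -> s != 0.
Proof. by move=> ps; apply/eqP => s0; apply: ps; rewrite s0; exact: prime_set0. Qed.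

Lemma notpM s t : OF s -> OF t -> ~ prime_set p s -> ~ prime_set p t ->
  ~ prime_set p (s * t).
Proof. by move=> Os Ot ps pt /(prime_mul Os Ot)[]. Qed.

Lemma OF_Oloc x : OF x -> Oloc x.
Proof.
move=> Ox; exists x, 1; split=> //; [exact: (OF_nat 1)|exact: prime1|].
by rewrite divr1.
Qed.

Lemma OlocB x y : Oloc x -> Oloc y -> Oloc (x - y).
Proof.
move=> [a [s [Oa Os ps ->]]] [b [t [Ob Ot pt ->]]].
exists (a * t - b * s), (s * t); split.
- by apply: integral_sub; apply: integral_mul.
- exact: integral_mul.
- exact: notpM.
by rewrite -mulNr addf_div ?mulNr ?notp_neq0.
Qed.

Lemma OlocM x y : Oloc x -> Oloc y -> Oloc (x * y).
Proof.
move=> [a [s [Oa Os ps ->]]] [b [t [Ob Ot pt ->]]].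
exists (a * b), (s * t); split; try exact: integral_mul.
  exact: notpM.
by rewrite mulf_div.
Qed.

Lemma Oloc0 : Oloc 0. Proof. exact/OF_Oloc/(OF_nat 0). Qed.

Lemma OlocN x : Oloc x -> Oloc (- x).
Proof. by move=> Ox; rewrite -sub0r; apply: OlocB => //; exact: Oloc0. Qed.

Lemma OlocD x y : Oloc x -> Oloc y -> Oloc (x + y).
Proof. by move=> Ox Oy; rewrite -[y]opprK; apply/OlocB => //; exact: OlocN. Qed.

(* [Oloc] is a discrete valuation ring with fraction field [F], so the nonzero
   multiples d * Oloc are the powers of its maximal ideal: they form a base of
   neighbourhoods of 0 for the p-adic topology of [F]. *)
Definition cauchy (s : nat -> F) := forall d, d != 0 -> exists N : nat,
  forall i j, (N <= i)%N -> (N <= j)%N -> Oloc ((s i - s j) / d).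

Definition cvg0 (s : nat -> F) := forall d, d != 0 -> exists N : nat,
  forall i, (N <= i)%N -> Oloc (s i / d).

Definition cauchy_seq : {pred nat -> F} := fun s => `[< cauchy s >].

Lemma cauchy_bounded s : cauchy s -> exists2 e : F, e != 0 &
  exists N : nat, forall i, (N <= i)%N -> Oloc (e * s i).
Proof.
move=> /(_ 1 (oner_neq0 _))[N cN]; have [e [Oe e0 Oes]] := OF_clear (s N).
exists e => //; exists N => i Ni.
rewrite -[s i](subrK (s N)) mulrDr; apply: OlocD; last exact: OF_Oloc.
by apply: OlocM; [exact: OF_Oloc|rewrite -[_ - _]divr1; exact: cN].
Qed.

Lemma cauchy_subring_closed : subring_closed cauchy_seq.
Proof.
split.
- by apply/asboolP => d _; exists 0%N => i j _ _; rewrite subrr mul0r; exact: Oloc0.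
- move=> s t /asboolP cs /asboolP ct; apply/asboolP => d d0.
  have [N cN] := cs d d0; have [M cM] := ct d d0.
  exists (maxn N M) => i j; rewrite !geq_max => /andP[Ni Mi] /andP[Nj Mj].
  rewrite (_ : _ / d = (s i - s j) / d - (t i - t j) / d); last first.
    by rewrite -mulrBl; congr (_ / d); rewrite /= !opprD !opprK addrACA.
  by apply: OlocB; [apply: cN|apply: cM].
- move=> s t /asboolP cs /asboolP ct; apply/asboolP => d d0.
  have [e e0 [N1 bs]] := cauchy_bounded cs.
  have [f f0 [N2 bt]] := cauchy_bounded ct.
  have [N3 cN] := cs (d * f) (mulf_neq0 d0 f0).
  have [N4 cM] := ct (d * e) (mulf_neq0 d0 e0).
  exists (maxn (maxn N1 N2) (maxn N3 N4)) => i j; rewrite !geq_max.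
  move=> /andP[/andP[i1 i2] /andP[i3 i4]] /andP[/andP[j1 j2] /andP[j3 j4]].
  rewrite (_ : _ / d = (e * s i) * ((t i - t j) / (d * e)) +
                       ((s i - s j) / (d * f)) * (f * t j)).
    by apply: OlocD; apply: OlocM; auto.
  have -> : (s * t) i - (s * t) j = s i * (t i - t j) + (s i - s j) * t j.
    by rewrite mulrBr mulrBl addrA subrK.
  rewrite mulrDl; congr (_ + _).
    by rewrite invfM [e * _]mulrC -!mulrA; congr (_ * _); rewrite mulrCA;
       congr (_ * _); rewrite mulrCA mulfV // mulr1.
  by rewrite invfM -!mulrA; congr (_ * _); rewrite mulKf // mulrC.
Qed.

HB.instance Definition _ :=
  GRing.isSubringClosed.Build (nat -> F) cauchy_seq cauchy_subring_closed.

Record cauchyType := CauchySeq { cauchy_val : nat -> F;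
  cauchy_valP : cauchy_val \in cauchy_seq }.
HB.instance Definition _ := [isSub for cauchy_val].
HB.instance Definition _ := [Choice of cauchyType by <:].
HB.instance Definition _ := [SubChoice_isSubComNzRing of cauchyType by <:].

Definition null_seq : {pred cauchyType} := fun s => `[< cvg0 (cauchy_val s) >].

Lemma null_idealr : idealr_closed null_seq.
Proof.
split.
- by apply/asboolP => d _; exists 0%N => i _; rewrite mul0r; exact: Oloc0.
- have [x px x0] := prime_nz p.
  apply/asboolP => /(_ x x0)[N /(_ N (leqnn N))].
  move=> [a [s [Oa Os ps xas]]]; have s0 := notp_neq0 ps; apply: ps.
  have -> : s = a * x; last first.
    exact: (primeM Oa px).
  have {}xas : x^-1 = a / s.
    by rewrite -[LHS]mul1r; exact: xas.
  have -> : a = x^-1 * s by rewrite xas divfK.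
  by rewrite mulrAC mulVf ?mul1r.
- move=> a s t /asboolP ns /asboolP nt; apply/asboolP => d d0.
  have [e e0 [N1 ba]] := cauchy_bounded (asboolP _ (cauchy_valP a)).
  have [N2 cs] := ns (d * e) (mulf_neq0 d0 e0).
  have [N3 ct] := nt d d0.
  exists (maxn N1 (maxn N2 N3)) => i; rewrite !geq_max => /and3P[i1 i2 i3].
  rewrite [X in X / _](_ : _ =
    cauchy_val a i * cauchy_val s i + cauchy_val t i) //.
  rewrite mulrDl; apply: OlocD; last exact: ct.
  rewrite (_ : _ / d =
    (e * cauchy_val a i) * (cauchy_val s i / (d * e))).
    by apply: OlocM; auto.
  by rewrite invfM [e * _]mulrC -!mulrA; congr (_ * _); rewrite mulrCA;
     congr (_ * _); rewrite mulrCA mulfV // mulr1.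
Qed.

HB.instance Definition _ := isIdealr.Build cauchyType null_seq null_idealr.

(* A field, but only its unit ring structure is needed. *)
Definition Fp : Type := {ideal_quot null_seq}.
HB.instance Definition _ := GRing.ComNzRing.on Fp.

Definition Fp_unit : {pred Fp} := fun x => `[< exists y, y * x = 1 >].

Definition Fp_inv (x : Fp) : Fp :=
  if pselect (exists y, y * x = 1) is left ex then projT1 (cid ex) else x.

Lemma Fp_mulVx : {in Fp_unit, left_inverse 1 Fp_inv *%R}.
Proof.
move=> x /asboolP ux; rewrite /Fp_inv.
by case: pselect => // ex; exact: projT2 (cid ex).
Qed.

Lemma Fp_unitPl (x y : Fp) : y * x = 1 -> Fp_unit x.
Proof. by move=> yx; apply/asboolP; exists y. Qed.

Lemma Fp_invr_out : {in [predC Fp_unit], Fp_inv =1 id}.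
Proof.
by move=> x /asboolP nux; rewrite /Fp_inv; case: pselect.
Qed.

HB.instance Definition _ := GRing.ComNzRing_hasMulInverse.Build Fp
  Fp_mulVx Fp_unitPl Fp_invr_out.

Lemma cauchy_const (a : F) : (fun=> a) \in cauchy_seq.
Proof.
by apply/asboolP => d _; exists 0%N => i j _ _; rewrite subrr mul0r; exact: Oloc0.
Qed.

Definition Fp_of (a : F) : Fp := \pi_Fp%qT (CauchySeq (cauchy_const a)).

Lemma Fp_of_is_zmod_morphism : zmod_morphism Fp_of.
Proof.
move=> a b; rewrite /Fp_of -rmorphB; congr (\pi%qT _).
exact: val_inj.
Qed.

Lemma Fp_of_is_monoid_morphism : monoid_morphism Fp_of.
Proof.
split=> [|a b]; rewrite /Fp_of.
  by rewrite -(rmorph1 \pi_Fp%qT); congr (\pi%qT _); exact: val_inj.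
by rewrite -rmorphM; congr (\pi%qT _); exact: val_inj.
Qed.

HB.instance Definition _ :=
  GRing.isZmodMorphism.Build F Fp Fp_of Fp_of_is_zmod_morphism.
HB.instance Definition _ :=
  GRing.isMonoidMorphism.Build F Fp Fp_of Fp_of_is_monoid_morphism.

(* The valuation ring of [Fp], as the closure of the local ring at [p]. *)
Definition Op : set Fp := [set x | exists s : cauchyType,
  (forall i, Oloc (cauchy_val s i)) /\ x = \pi_Fp%qT s].

Definition Op_unit : set Fp := [set x | [/\ x \is a GRing.unit, Op x & Op x^-1]].

End Localization.

Section Modules.
Variables (K : nzRingType) (M : lmodType K).
Implicit Types (A : set K) (X : set M).

Definition lspan A X : set M := [set v | exists k (c : 'I_k -> K) (x : 'I_k -> M),
  [/\ forall i, A (c i), forall i, X (x i) & v = \sum_i c i *: x i]].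

Definition is_basis n A X (b : 'I_n -> M) :=
  (forall v, X v <->
    exists2 c : 'I_n -> K, forall i, A (c i) & v = \sum_i c i *: b i) /\
  (forall c : 'I_n -> K, (forall i, A (c i)) -> \sum_i c i *: b i = 0 ->
    forall i, c i = 0).

End Modules.

Section QuadraticForms.
Variables (K : comNzRingType) (M : lmodType K).
Implicit Type Q : M -> K.

Definition polar Q (u v : M) : K := Q (u + v) - Q u - Q v.

(* [polar Q] is symmetric, so linearity in one variable is enough. *)
Definition quadratic_form Q :=
  (forall a v, Q (a *: v) = a ^+ 2 * Q v) /\
  (forall v, scalar (polar Q ^~ v)).

Definition nondegenerate_form Q :=
  forall u, (forall v, polar Q u v = 0) -> u = 0.

(* The polynomial Q (\sum_i x_i b_i) in the indeterminates x_i. *)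
Definition form_poly n Q (b : 'I_n -> M) : {mpoly K[n]} :=
  \sum_(i < n) Q (b i) *: 'X_i ^+ 2 +
  \sum_(i < n) \sum_(j < n | (i < j)%N) polar Q (b i) (b j) *: ('X_i * 'X_j).

End QuadraticForms.

(* The second derivatives of a quadratic form are constants; they are read off
   as values at 0. *)
Definition hessian (K : comNzRingType) n (q : {mpoly K[n]}) : 'M[K]_n :=
  \matrix_(i, j) meval (fun=> 0) (mderiv i (mderiv j q)).

Record quad_lattice (F : fieldExtType rat) (n : nat) := QuadLattice {
  qspace : vectType F;
  qspace_dim : \dim {: qspace} = n;
  qform : qspace -> F;
  qformP : quadratic_form qform;
  lattice : set qspace;
  lattice_fg : exists g : seq qspace, lattice = lspan (@OF F) [set v | v \in g];
  lattice_full : lspan setT lattice = setT }.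

Arguments qform {F n} q _.
Arguments lattice {F n} q _.

Section LocalLattice.
Variables (F : fieldExtType rat) (n : nat) (L : quad_lattice F n).
Variable p : prime_ideal F.
Let V := qspace L.

(* [V (x) Fp] in the coordinates given by the F-basis [vbasis {: V}]; the image of v
   is [loc_vec v].  Since [Op] is flat over [OF], the natural map from
   [L (x) Op] to [V (x) Fp] is injective, with image the [Op]-span of L. *)
Definition loc_space := 'rV[Fp p]_(\dim {: V}).

Definition loc_vec (v : V) : loc_space :=
  \row_i Fp_of p (coord (vbasis {: V}) i v).

Definition loc_lattice : set loc_space := lspan (@Op F p) (loc_vec @` lattice L).

Definition loc_form (w : loc_space) : Fp p :=
  meval (fun i => w 0 i)
    (map_mpoly (Fp_of p) (form_poly (qform L) (tnth (vbasis {: V})))).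

Definition detH_at : set (Fp p) := [set d | exists (b : 'I_n -> loc_space) u,
  [/\ is_basis (@Op F p) loc_lattice b, Op_unit u &
      d = \det (hessian (form_poly loc_form b)) * u ^+ 2]].

End LocalLattice.

Arguments detH_at {F n} L p _.

Record finite_idele (F : fieldExtType rat) := FiniteIdele {
  idele_val :> forall p : prime_ideal F, Fp p;
  idele_unit : forall p, idele_val p \is a GRing.unit;
  idele_fin : finite_set [set p | ~ Op_unit (idele_val p)] }.

Definition idele_coset (F : fieldExtType rat) (s : finite_idele F) :
    set (finite_idele F) :=
  [set t : finite_idele F | exists2 u : forall p, Fp p,
     forall p, Op_unit (u p) & forall p, t p = s p * u p ^+ 2].

(* The quotient of the finite ideles by the squares of the unit ideles, as its
   set of cosets. *)
Record SqCl (F : fieldExtType rat) := SqClass {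
  sqcl_set : set (finite_idele F);
  sqcl_coset : exists s, sqcl_set = idele_coset s }.

Definition sqcl_at (F : fieldExtType rat) (S : SqCl F) (p : prime_ideal F) :
  set (Fp p) := [set t p | t in sqcl_set S].

Arguments sqcl_at {F} S p _.

Definition is_detH (F : fieldExtType rat) n (L : quad_lattice F n) (S : SqCl F) :=
  forall p, sqcl_at S p = detH_at L p.

Definition globally_rational (F : fieldExtType rat) (S : SqCl F) :=
  exists2 a : F, a != 0 & forall p,
    sqcl_at S p `<=` [set Fp_of p a * t ^+ 2 | t in [set t | t \is a GRing.unit]].

(* Main.v *)
(* If [L] has Hessian determinant squareclass [S], then the Gram determinant [a] of
   a global [F]-basis represents [S]: a local basis of [L] at [p] differs from the global
   one by a matrix [C] over [Fp p], and the Hessian determinant becomes [a * \det C ^+ 2].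

   Conversely let [S] be represented at [p] by [a * t_p ^+ 2].  Up to local units [t_p]
   lies in [F], and it is a unit for almost all [p], so there is a fractional ideal [I] of
   [F] with [I * Op = t_p * Op] for all [p].  The lattice
   [I e_0 + OF e_1 + ... + OF e_{n-1}] with the form
   [(a x_0 ^ 2 + x_1 ^ 2 + ... + x_{n-1} ^ 2) / 2] has the required determinant.

   The ideal [I] is given by two generators found with the Chinese remainder theorem.
   No discrete valuation is needed for this, only the fact that for [z] in [p] and
   [d != 0] some power of [z] is divisible by [d] in [Oloc p]; this also shows that
   nonzero primes are maximal. *)

From HB Require Import structures.
Require Import Defs.
From mathcomp Require Import all_boot all_order all_algebra all_field.
From mathcomp Require Import boolp classical_sets functions cardinality mpoly.
From mathcomp Require Import ring.

Set Implicit Arguments.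
Unset Strict Implicit.
Unset Printing Implicit Defensive.

Import GRing.Theory Num.Theory.
Local Open Scope classical_set_scope.
Local Open Scope ring_scope.

(** * Primes of the ring of integers *)

Section PrimeIdeals.
Variable F : fieldExtType rat.
Implicit Types (p q : prime_ideal F) (x z d s w : F).

Lemma OF_int (m : int) : OF (m%:~R : F).
Proof. exact: integral_id. Qed.

Lemma OF_mul x y : OF x -> OF y -> OF (x * y).
Proof. exact: integral_mul. Qed.

Lemma OF_add x y : OF x -> OF y -> OF (x + y).
Proof. exact: integral_add. Qed.

Lemma OF_sum (I : Type) (r : seq I) (P : pred I) (f : I -> F) :
  (forall i, P i -> OF (f i)) -> OF (\sum_(i <- r | P i) f i).
Proof. by move=> ?; apply: big_ind => //; [exact: (OF_nat F 0)|exact: OF_add]. Qed.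

Lemma OF_prod (I : Type) (r : seq I) (P : pred I) (f : I -> F) :
  (forall i, P i -> OF (f i)) -> OF (\prod_(i <- r | P i) f i).
Proof. by move=> ?; apply: big_ind => //; [exact: (OF_nat F 1)|exact: OF_mul]. Qed.

Lemma OF_exp x k : OF x -> OF (x ^+ k).
Proof.
move=> Ox; elim: k => [|k IHk]; first exact: (OF_nat F 1).
by rewrite exprS; apply: OF_mul.
Qed.

Lemma OF_horner (g : {poly int}) x : OF x -> OF (map_poly intr g).[x].
Proof.
move=> Ox; apply: integral_horner => //; apply/integral_poly => i.
by rewrite coef_map; exact: OF_int.
Qed.

Lemma prime_setN p x : prime_set p x -> prime_set p (- x).
Proof. by rewrite -mulN1r => px; apply: primeM px; exact: (OF_int (- 1)). Qed.

Lemma prime_setB p x y : prime_set p x -> prime_set p y -> prime_set p (x - y).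
Proof. by move=> px py; apply: primeD => //; exact: prime_setN. Qed.

Lemma prime_setMl p a x : OF a -> prime_set p x -> prime_set p (x * a).
Proof. by move=> Oa px; rewrite mulrC; exact: primeM. Qed.

Lemma prime_setX p x k : OF x -> prime_set p (x ^+ k) -> prime_set p x.
Proof.
move=> Ox; elim: k => [/prime1//|k IHk].
by rewrite exprS => /prime_mul[]//; exact: OF_exp.
Qed.

Lemma prime_set_sum p (I : Type) (r : seq I) (P : pred I) (f : I -> F) :
  (forall i, P i -> prime_set p (f i)) -> prime_set p (\sum_(i <- r | P i) f i).
Proof. by move=> ?; apply: big_ind => //; [exact: prime_set0|exact: primeD]. Qed.

Lemma notp_prod p (I : Type) (r : seq I) (P : pred I) (f : I -> F) :
  (forall i, P i -> OF (f i) /\ ~ prime_set p (f i)) ->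
  ~ prime_set p (\prod_(i <- r | P i) f i).
Proof.
move=> fP; suff [] : OF (\prod_(i <- r | P i) f i) /\
  ~ prime_set p (\prod_(i <- r | P i) f i) by [].
apply: (big_ind (fun x => OF x /\ ~ prime_set p x)) => //.
  by split; [exact: (OF_nat F 1)|exact: prime1].
by move=> x y [Ox px] [Oy py]; split; [exact: OF_mul|exact: notpM].
Qed.

(** After factors ['X] are removed from a monic equation of [d], its constant term is a nonzero
    integer divisible by [d]; its absolute value is the required [m]. *)
Lemma OF_dvd_nat d : OF d -> d != 0 ->
  exists2 m : nat, (0 < m)%N & exists2 w, OF w & m%:R = d * w.
Proof.
move=> Od d0; have [g mg rg] := Od; have := monic_neq0 mg.
elim/poly_ind: g rg {mg} => [|g c IHg]; first by rewrite eqxx.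
rewrite rmorphD rmorphM /= map_polyX map_polyC rootE hornerMXaddC.
have [->|c0 rg _] := eqVneq c 0.
  rewrite /= addr0 mulf_eq0 (negPf d0) orbF addr0 => /IHg gP.
  by rewrite mulf_eq0 negb_or => /andP[/gP].
exists `|c|%N; first by rewrite absz_gt0.
exists (- (sgz c)%:~R * (map_poly intr g).[d]).
  by apply: OF_mul; [exact/integral_opp/OF_int|exact: OF_horner].
move: rg => /eqP/(canRL (addKr _)); rewrite addr0 => gd.
rewrite mulrCA [d * _]mulrC mulNr -mulrN -gd -intrM -abszEsg.
by rewrite -pmulrn.
Qed.

Lemma nat_in_prime p m : (0 < m)%N -> prime_set p m%:R ->
  exists2 l : nat, l \in primes m & prime_set p l%:R.
Proof.
elim/ltn_ind: m => m IHm m_gt0 pm.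
have m_gt1 : (1 < m)%N.
  by case: m m_gt0 pm {IHm} => [|[|m]]// _; move/prime1.
have lm := pdiv_dvd m; have l_gt0 := pdiv_gt0 m.
move: pm; rewrite -{1}(divnK lm) natrM => /prime_mul[||pm|pl].
- exact: OF_nat.
- exact: OF_nat.
- have [] := IHm _ _ _ pm.
  + by rewrite ltn_Pdiv // prime_gt1 // pdiv_prime.
  + by rewrite divn_gt0 // dvdn_leq.
  + move=> l; rewrite !mem_primes => /and3P[l_pr _ lm'] pl.
    by exists l => //; rewrite mem_primes l_pr m_gt0 (dvdn_trans lm') // dvdn_div.
- by exists (pdiv m) => //; rewrite mem_primes pdiv_prime // m_gt0.
Qed.

(** Otherwise a Bezout relation between [l] and [m] would put 1 in [p]. *)
Lemma int_in_prime p (l : nat) (m : int) : prime l -> prime_set p l%:R ->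
  prime_set p m%:~R -> (l %| m)%Z.
Proof.
move=> l_pr pl pm; apply: contrapT => /negP lm.
have /eqP lm1 : coprimez l m.
  by rewrite /coprimez -[_ == _]/(coprime l `|m|) prime_coprime.
have [u [v uv]] := Bezoutz l m; apply: (@prime1 _ p).
rewrite -[1]/(1%:~R) -lm1 -uv rmorphD !rmorphM /=.
by apply: primeD; apply: primeM => //; exact: OF_int.
Qed.

(* If [g`_i] is the lowest coefficient of [g] prime to [l], then
   [g.[z] = z ^+ i * s] modulo [l], where [s] has constant term [g`_i]. *)
Lemma poly_prime_exp p (l : nat) z (g : {poly int}) :
    prime l -> prime_set p l%:R -> prime_set p z -> (exists i, ~ (l %| g`_i)%Z) ->
  exists s k w, [/\ OF s, ~ prime_set p s, OF w &
    s * z ^+ k = l%:R * w + (map_poly intr g).[z]].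
Proof.
move=> l_pr pl pz; have Oz := prime_sub pz.
elim/poly_ind: g => [|g c IHg] [i lg]; first by case: lg; rewrite coef0 dvdz0.
have [lc|lc] := boolP (l %| c)%Z; last first.
  (* The constant term [c] is prime to [l]: the value of the polynomial at [z] is congruent to [c]
     modulo [p], hence is itself a valid [s], with [k = 0]. *)
  exists (map_poly intr (g * 'X + c%:P)).[z], 0%N, 0.
  split; [exact: OF_horner| |exact: (OF_nat F 0)|by rewrite mulr0 add0r mulr1].
  rewrite rmorphD rmorphM /= map_polyX map_polyC hornerMXaddC /= => pgc.
  case/negP: lc; apply: (int_in_prime l_pr pl).
  rewrite -[_%:~R](addKr ((map_poly intr g).[z] * z)) addrC; apply: prime_setB => //.
  by apply: primeM => //; exact: OF_horner.
(* When [l] divides [c], the relation for [g] is multiplied by [z], and [c] is absorbed in the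
   multiple of [l]. *)
have [|s [k [w [Os ps Ow szk]]]] := IHg.
  case: i lg => [|i]; rewrite coefD coefMX coefC ?add0r ?addr0 //.
  by exists i.
have /dvdzP[c' cE] := lc.
exists s, k.+1, (w * z - c'%:~R); split=> //.
  by apply: integral_sub; [exact: OF_mul|exact: OF_int].
rewrite exprSr mulrA szk rmorphD rmorphM /= map_polyX map_polyC hornerMXaddC /=.
rewrite mulrDl cE rmorphM /= mulrBr !addrA addrAC; congr (_ + _).
by rewrite [c'%:~R * _]mulrC -addrA addNr addr0 mulrA.
Qed.

(* The radical of [d * Oloc p] is the maximal ideal of [Oloc p]. *)
Lemma prime_exp_dvd p z d : prime_set p z -> OF d -> d != 0 ->
  exists s k w, [/\ OF s, ~ prime_set p s, OF w & s * z ^+ k = d * w].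
Proof.
move=> pz Od d0; have Oz := prime_sub pz.
have [m m_gt0 [w0 Ow0 mE]] := OF_dvd_nat Od d0.
suff [s [k [w [Os ps Ow szk]]]] : exists s k w,
    [/\ OF s, ~ prime_set p s, OF w & s * z ^+ k = m%:R * w].
  exists s, k, (w0 * w); split=> //; first exact: OF_mul.
  by rewrite szk mE mulrA.
(* [d] has been replaced by its multiple [m]; relations for the prime factors of [m] are now
   multiplied together. *)
elim/ltn_ind: m m_gt0 {mE} => m IHm m_gt0.
have [m_le1|m_gt1] := leqP m 1.
  have -> : m = 1%N by apply/eqP; rewrite eqn_leq m_le1.
  exists 1, 0%N, 1.
  by split; [exact: (OF_nat F 1)|exact: prime1|exact: (OF_nat F 1)|].
have l_pr := pdiv_prime m_gt1; set l := pdiv m in l_pr.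
have [s1 [k1 [w1 [Os1 ps1 Ow1 E1]]]] : exists s k w,
    [/\ OF s, ~ prime_set p s, OF w & s * z ^+ k = l%:R * w].
  have [pl|npl] := pselect (prime_set p l%:R); last first.
    exists l%:R, 0%N, 1; split=> //; [exact: OF_nat|exact: (OF_nat F 1)].
  (* A monic equation of [z] has leading coefficient 1, prime to [l], and its value at [z]
     vanishes. *)
  have [g mg rg] := Oz.
  have [|s [k [w [Os ps Ow E]]]] := @poly_prime_exp p l z g l_pr pl pz.
    exists (size g).-1; rewrite -lead_coefE (monicP mg) dvdz1 => /eqP/eqP.
    by rewrite absz_nat => /eqP l1; move: l_pr; rewrite l1.
  by exists s, k, w; split=> //; move: rg; rewrite rootE E => /eqP->; rewrite addr0.
have [||s2 [k2 [w2 [Os2 ps2 Ow2 E2]]]] := IHm (m %/ l)%N.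
- by rewrite ltn_Pdiv // prime_gt1.
- by rewrite divn_gt0 ?prime_gt0 // dvdn_leq // pdiv_dvd.
exists (s1 * s2), (k1 + k2)%N, (w1 * w2); split; try exact: OF_mul.
  exact: notpM.
rewrite exprD mulrACA E1 E2 mulrACA -natrM [(l * _)%N]mulnC divnK //.
exact: pdiv_dvd.
Qed.

Lemma prime_ideal_eq p q : prime_set p = prime_set q -> p = q.
Proof.
case: p q => [s1 a1 b1 c1 d1 e1 f1] [s2 a2 b2 c2 d2 e2 f2] /= E; subst s2.
by congr PrimeIdeal; exact: Prop_irrelevance.
Qed.

(** For nonzero [d] in [p] and [z] in [q], some [s * z ^+ k] is a multiple of [d] with [s] outside
    [q]; as [s] is then outside [p], [z] lies in [p]. *)
Lemma prime_maximal p q : prime_set p `<=` prime_set q -> p = q.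
Proof.
move=> pq; apply/prime_ideal_eq/seteqP; split=> // z qz.
have [d pd d0] := prime_nz p.
have [s [k [w [Os qs Ow szk]]]] := prime_exp_dvd qz (prime_sub pd) d0.
have Oz := prime_sub qz; have : prime_set p (s * z ^+ k).
  by rewrite szk; exact: prime_setMl.
case/prime_mul => [//|||/(prime_setX Oz)//]; first exact: OF_exp.
by move/pq.
Qed.

Lemma prime_avoid p q : p <> q -> exists2 z, prime_set p z & ~ prime_set q z.
Proof.
move=> pq; apply: contrapT => npq; apply: pq; apply: prime_maximal => z pz.
by apply: contrapT => qz; apply: npq; exists z.
Qed.

(** More than [\dim {: F}] elements are linearly dependent over the rationals; clearing denominators
    and dividing by the content gives a primitive integral relation. *)
Lemma int_relation (l : nat) (v : 'I_(\dim {: F}).+1 -> F) : prime l ->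
  exists c : 'I_(\dim {: F}).+1 -> int,
    \sum_i (c i)%:~R * v i = 0 /\ exists i, ~ (l %| c i)%Z.
Proof.
move=> l_pr; set N := (\dim {: F}).+1.
have : ~~ free [tuple v i | i < N].
  apply/negP => /eqP; rewrite size_tuple => dimN.
  by have := dimvS (subvf <<[tuple v i | i < N]>>); rewrite dimN ltnn.
move/freeP => nfree.
have [k [k0 [i0 ki0]]] : exists k : 'I_N -> rat,
    \sum_(i < N) k i *: v i = 0 /\ exists i, k i != 0.
  apply: contrapT => nk; apply: nfree => k sk i; apply/eqP/negPn/negP => ki.
  apply: nk; exists k; split; last by exists i.
  by apply: etrans sk; apply: eq_bigr => j _; rewrite -tnth_nth tnth_mktuple.
have [q [a a0 kE]] := rat_poly_scale (\poly_(i < N) k (inord i)).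
have kq (i : 'I_N) : k i = a%:~R^-1 * (q`_i)%:~R.
  have := congr1 (fun g : {poly rat} => g`_i) kE.
  by rewrite coef_poly ltn_ord inord_val coefZ coef_map.
have q0 : q != 0.
  by apply: contraNneq ki0 => q0; rewrite kq q0 coef0 mulr0.
set g := zprimitive q.
have qg i : q`_i = zcontents q * g`_i by rewrite [in LHS](zpolyEprim q) coefZ.
have zc0 : zcontents q != 0 by rewrite zcontents_eq0.
exists (fun i => g`_i); split.
  have : a%:~R^-1 * (zcontents q)%:~R != 0 :> rat.
    by rewrite mulf_neq0 ?invr_eq0 ?intr_eq0.
  set b := (_ * _) => /negPf b0; apply/eqP.
  suff /eqP : b *: (\sum_(i < N) (g`_i)%:~R * v i) = 0 by rewrite scaler_eq0 b0.
  rewrite scaler_sumr; apply: etrans k0; apply: eq_bigr => i _.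
  rewrite kq qg rmorphM /= mulrA -[RHS]scalerA; congr (_ *: _).
  by rewrite -[(g`_i)%:~R](rmorph_int (in_alg F)) /= mulr_algl.
apply: contrapT => ng.
have : (l %| zcontents g)%Z.
  rewrite dvdz_contents; apply/polyOverP => j.
  have [jN|jN] := ltnP j N.
    by apply/negPn/negP => /negP lg; apply: ng; exists (Ordinal jN).
  suff -> : g`_j = 0 by exact: dvdz0.
  apply: nth_default.
  rewrite /g size_zprimitive; apply: leq_trans _ jN.
  have <- : size (a%:~R^-1 *: map_poly intr q : {poly rat}) = size q.
    by rewrite size_scale ?invr_eq0 ?intr_eq0 // size_map_inj_poly //; exact: intr_inj.
  by rewrite -kE size_poly.
rewrite zcontents_primitive q0 dvdz1 absz_nat => /eqP l1.
by move: l_pr; rewrite l1.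
Qed.

(* A system of elements [e i] in all of the primes but the [i]-th has no integral
   relation that is nontrivial modulo [l], so there are at most [\dim F] of them. *)
Lemma finite_primes_over (l : nat) : prime l ->
  finite_set [set p : prime_ideal F | prime_set p l%:R].
Proof.
move=> l_pr; apply: contrapT => /infiniteP/card_leP[f0].
pose f (j : nat) : prime_ideal F := set_val (f0 (exist _ j (mem_setT j))).
have fl j : prime_set (f j) l%:R.
  exact: set_valP (f0 _).
have finj i j : f i = f j -> i = j.
  by move/val_inj/(@inj _ _ _ f0 _ _ (mem_setT _) (mem_setT _)) => [].
(* [x (i, j)] lies in the [j]-th prime and not in the [i]-th; the value 0 for [i = j] is a dummy. *)
have /choice[x xP] (ij : nat * nat) : exists x, OF x /\
    (ij.1 <> ij.2 -> prime_set (f ij.2) x /\ ~ prime_set (f ij.1) x).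
  case: ij => i j /=; have [->|/eqP ij] := eqVneq i j.
    by exists 0; split=> //; exact: (OF_nat F 0).
  have [|z pz qz] := @prime_avoid (f j) (f i).
    by move/finj/esym.
  by exists z; split=> //; exact: prime_sub pz.
pose e (i : 'I_(\dim {: F}).+1) : F :=
  \prod_(j < (\dim {: F}).+1 | j != i) x (i : nat, j : nat).
have Oe i : OF (e i) by apply: OF_prod => j _; case: (xP (i : nat, j : nat)).
(* Modulo the [i0]-th prime only the term of index [i0] survives, so [c i0] lies in that prime and
   is divisible by [l], against the choice of [i0]. *)
have [c [ce0 [i0]]] := int_relation e l_pr; apply.
apply: (@int_in_prime (f i0)) => //.
have pe i : i != i0 -> prime_set (f i0) (e i).
  move=> ii0; rewrite /e (bigD1 i0) 1?eq_sym //=.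
  apply: prime_setMl; first by apply: OF_prod => j _; case: (xP (i : nat, j : nat)).
  by have [_ []] := xP (i : nat, i0 : nat) => //=; move/val_inj/eqP; exact/negP.
have npe : ~ prime_set (f i0) (e i0).
  apply: notp_prod => j ji0; have [Ox []] := xP (i0 : nat, j : nat) => //=.
  by move/val_inj/esym/eqP; exact/negP.
have : prime_set (f i0) ((c i0)%:~R * e i0).
  move: ce0; rewrite (bigD1 i0) //= => /eqP; rewrite addr_eq0 => /eqP->.
  apply/prime_setN/prime_set_sum => i /pe.
  by apply: primeM; exact: OF_int.
by case/prime_mul => //; exact: OF_int.
Qed.

(** Such a prime contains a positive integer multiple of [x], hence one of the finitely many prime
    factors of that integer. *)
Lemma finite_primes_dvd x : OF x -> x != 0 ->
  finite_set [set p : prime_ideal F | prime_set p x].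
Proof.
move=> Ox x0; have [m m_gt0 [w Ow mE]] := OF_dvd_nat Ox x0.
apply: (@sub_finite_set _ _
  (\bigcup_(l in [set` primes m]) [set p : prime_ideal F | prime_set p l%:R])).
  move=> p px; have [|l lm pl] := @nat_in_prime p m m_gt0; last by exists l.
  by rewrite mE; exact: prime_setMl.
apply: bigcup_finite => // l /=; rewrite mem_primes => /and3P[l_pr _ _].
exact: finite_primes_over.
Qed.

(** * Units of the local rings *)

Definition Oloc_unit p x := [/\ x != 0, Oloc p x & Oloc p x^-1].

Lemma Oloc1 p : Oloc p 1.
Proof. exact/OF_Oloc/(OF_nat F 1). Qed.

Lemma Oloc_unitM p x y : Oloc_unit p x -> Oloc_unit p y -> Oloc_unit p (x * y).
Proof.
move=> [x0 Ox Ox'] [y0 Oy Oy']; split; [exact: mulf_neq0|exact: OlocM|].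
by rewrite invfM; exact: OlocM.
Qed.

Lemma Oloc_unitV p x : Oloc_unit p x -> Oloc_unit p x^-1.
Proof. by move=> [x0 Ox Ox']; split; rewrite ?invr_eq0 ?invrK. Qed.

Lemma Oloc_unit_notp p s : OF s -> ~ prime_set p s -> Oloc_unit p s.
Proof.
move=> Os ps; split; [exact: (notp_neq0 ps)|exact: OF_Oloc|].
by exists 1, s; split=> //; [exact: (OF_nat F 1)|rewrite mul1r].
Qed.

(** Writing [w = a / s], the numerator [c * s + z * a] stays outside [p], being congruent to
    [c * s]. *)
Lemma Oloc_unitD p c z w : OF c -> ~ prime_set p c -> prime_set p z -> Oloc p w ->
  Oloc_unit p (c + z * w).
Proof.
move=> Oc pc pz [a [s [Oa Os ps ->]]].
have s0 := notp_neq0 ps; have Oz := prime_sub pz.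
have -> : c + z * (a / s) = (c * s + z * a) / s by rewrite mulrDl mulfK // mulrA.
apply: Oloc_unitM; last exact/Oloc_unitV/Oloc_unit_notp.
apply: Oloc_unit_notp.
  by apply: OF_add; exact: OF_mul.
move=> pcs; have : prime_set p (c * s).
  by rewrite -(addrK (z * a) (c * s)); apply: prime_setB pcs _; exact: prime_setMl.
by case/prime_mul.
Qed.

(** An instance of integral closedness: if [x ^+ 2 = a / s], then [(x * s) ^+ 2 = a * s] is
    integral, and substituting ['X^2] in its equation gives one for [x * s]. *)
Lemma Oloc_sqr p x : Oloc p (x ^+ 2) -> Oloc p x.
Proof.
move=> [a [s [Oa Os ps E]]]; have s0 := notp_neq0 ps.
exists (x * s), s; split=> //; last by rewrite mulfK.
have Osx : OF ((x * s) ^+ 2).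
  by rewrite exprMn E expr2 mulrA divfK //; exact: OF_mul.
have [g mg rg] := Osx; exists (g \Po 'X^2).
  rewrite monicE lead_coef_comp ?size_polyXn //.
  by rewrite lead_coefXn expr1n mulr1 -monicE.
rewrite map_comp_poly /= map_polyXn rootE horner_comp hornerXn; exact: rg.
Qed.

Lemma Oloc_unit_sqr p x : Oloc_unit p (x ^+ 2) -> Oloc_unit p x.
Proof.
move=> [x0 Ox Ox']; split; [by move: x0; rewrite sqrf_eq0|exact: Oloc_sqr|].
by apply: Oloc_sqr; rewrite exprVn.
Qed.

(** With [d] a denominator of [x], only the primes containing [d] or [d * x] can occur. *)
Lemma finite_nonunits x : x != 0 ->
  finite_set [set p : prime_ideal F | ~ Oloc_unit p x].
Proof.
move=> x0; have [d [Od d0 Odx]] := OF_clear x.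
have dx0 : d * x != 0 by rewrite mulf_neq0.
apply: (@sub_finite_set _ _
  ([set p : prime_ideal F | prime_set p d] `|` [set p | prime_set p (d * x)])).
  move=> p /= nu; apply: contrapT => /not_orP[pd pdx]; apply: nu.
  rewrite -(mulKf d0 x); apply: Oloc_unitM; last exact: Oloc_unit_notp.
  exact/Oloc_unitV/Oloc_unit_notp.
by rewrite finite_setU; split; exact: finite_primes_dvd.
Qed.

End PrimeIdeals.

HB.instance Definition _ (F : fieldExtType rat) := gen_eqMixin (prime_ideal F).
HB.instance Definition _ (F : fieldExtType rat) := gen_choiceMixin (prime_ideal F).

(** * Generators of fractional ideals by the Chinese remainder theorem *)

Section IdealGenerators.
Variable F : fieldExtType rat.
Implicit Types (p q r : prime_ideal F) (x y z d s w : F).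

(** A high power of an element of [r] outside [q] serves as [c]. *)
Lemma prime_coprime_dvd q r d : q <> r -> OF d -> d != 0 ->
  exists c, [/\ OF c, ~ prime_set q c & Oloc r (c / d)].
Proof.
move=> qr Od d0; have [z rz qz] := prime_avoid (nesym qr).
have [s [k [w [Os rs Ow szk]]]] := prime_exp_dvd rz Od d0.
exists (z ^+ k); split; first exact/OF_exp/prime_sub/rz.
  by move/(prime_setX (prime_sub rz)).
exists w, s; split=> //; have s0 := notp_neq0 rs.
by rewrite -[z ^+ k](mulKf s0) szk mulrA mulrAC mulfK // mulrC.
Qed.

(** The element is [\sum_q e q * a q], where [e q] is outside [q] and highly divisible at the other
    primes of [B], so that at [q] the term of index [q] dominates the sum. *)
Lemma chinese_generator (B : seq (prime_ideal F)) (a : prime_ideal F -> F) :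
    uniq B -> (forall q, OF (a q)) -> (forall q, a q != 0) ->
  exists2 y, OF y & forall q, q \in B -> Oloc_unit q (y / a q).
Proof.
move=> uB Oa a0.
(* The extra factor [u q] in the modulus [a q * u q] makes the remaining terms, divided by [a q],
   lie in the maximal ideal at [q]. *)
have /choice[u uP] q : exists u, prime_set q u /\ u != 0.
  by have [u] := prime_nz q; exists u.
have Ou q : OF (u q) by case: (uP q) => /prime_sub.
have Oau q : OF (a q * u q) := OF_mul (Oa q) (Ou q).
have au0 q : a q * u q != 0 by rewrite mulf_neq0 //; case: (uP q).
have /choice[c cP] (qr : prime_ideal F * prime_ideal F) : exists c, OF c /\
    (qr.1 <> qr.2 -> ~ prime_set qr.1 c /\ Oloc qr.2 (c / (a qr.2 * u qr.2))).
  case: qr => q r /=; have [->|/eqP qr] := eqVneq q r.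
    by exists 0; split=> //; exact: (OF_nat F 0).
  by have [c [? ? ?]] := prime_coprime_dvd qr (Oau r) (au0 r); exists c.
pose e q := \prod_(r <- B | r != q) c (q, r).
have Oe q : OF (e q) by apply: OF_prod => r _; case: (cP (q, r)).
exists (\sum_(q <- B) e q * a q); first by apply: OF_sum => q _; exact: OF_mul.
move=> q qB; rewrite (bigD1_seq q) //= mulrDl mulfK ?a0 //.
have -> : (\sum_(i <- B | i != q) e i * a i) / a q =
    u q * \sum_(i <- B | i != q) (e i / (a q * u q) * a i).
  rewrite !mulr_sumr mulr_suml; apply: eq_bigr => r _.
  have uq0 : u q != 0 by case: (uP q).
  rewrite invfM -!mulrA [RHS]mulrCA; congr (_ * _).
  by rewrite [RHS]mulrCA mulVKf // mulrC.
apply: Oloc_unitD => //.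
- apply: notp_prod => r /eqP rq; have [Oc] := cP (q, r).
  by case=> [/esym //|].
- by case: (uP q).
- apply: big_ind => [|x y|r rq]; [exact: Oloc0|exact: OlocD|].
  apply: OlocM; last exact: OF_Oloc.
  rewrite /e -big_filter (bigD1_seq q) ?filter_uniq ?mem_filter 1?eq_sym ?rq //=.
  rewrite mulrAC; apply: OlocM.
    by have [_ []] := cP (r, q) => //=; apply/eqP.
  by apply/OF_Oloc/OF_prod => i _; case: (cP (r, i)).
Qed.

(* [x] and [y] generate the fractional ideal attached to the finite idele [a]. *)
Lemma idele_ideal_generators (a : prime_ideal F -> F) :
    (forall p, a p != 0) -> finite_set [set p | ~ Oloc_unit p (a p)] ->
  exists x y, x != 0 /\ forall p, [/\ Oloc p (x / a p), Oloc p (y / a p) &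
    Oloc_unit p (x / a p) \/ Oloc_unit p (y / a p)].
Proof.
move=> a0 /finite_seqP[B BE].
have inB p : p \notin B -> Oloc_unit p (a p).
  move=> pB; apply: contrapT => nu; move/negP: pB; apply.
  by rewrite -[is_true _]/([set` B] p) -BE.
have /choice[d dP] p := OF_clear (a p).
(* [m] clears the denominators of [a] on [B]. The integral [b p] agrees with [m * a p] up to a local
   unit, since outside [B] the value [a p] is itself a unit. *)
pose m := \prod_(q <- B) d q.
have Om : OF m by apply: OF_prod => q _; case: (dP q).
have m0 : m != 0 by rewrite prodf_seq_neq0; apply/allP => q _; case: (dP q).
pose b p := if p \in B then m * a p else m.
have Ob p : OF (b p).
  rewrite /b; case: ifP => // pB; rewrite /m (big_rem p) //= mulrAC.
  by apply: OF_mul; [case: (dP p)|apply: OF_prod => q _; case: (dP q)].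
have b0 p : b p != 0 by rewrite /b; case: ifP => // _; rewrite mulf_neq0 ?a0.
have bu p : Oloc_unit p (b p / (m * a p)).
  rewrite /b; case: ifPn => [_|/inB].
    by rewrite divff ?mulf_neq0 ?a0 //; split; rewrite ?oner_neq0 ?invr1 //; exact: Oloc1.
  by rewrite invfM mulrA divff // mul1r; exact: Oloc_unitV.
(* A common multiple of all the [b p]; at primes not containing it, [x] and [b p] are both units. *)
pose x := m * \prod_(q <- B) b q.
have Ox : OF x by apply: OF_mul => //; exact: OF_prod.
have x0 : x != 0.
  by rewrite mulf_neq0 // prodf_seq_neq0; apply/allP => q _; exact: b0.
have bx p : OF (x / b p).
  have [pB|pB] := boolP (p \in B); last first.
    by rewrite /b (negPf pB) /x mulrAC divff // mul1r; exact: OF_prod.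
  rewrite /x (big_rem p) //= mulrCA mulrAC divff // mul1r.
  by apply: OF_mul => //; exact: OF_prod.
(* At the finitely many primes containing [x], a second generator [y] is chosen with [y / b p] a
   unit. *)
have /finite_seqP[C CE] := finite_primes_dvd Ox x0.
have [y Oy yP] := chinese_generator (undup_uniq C) Ob b0.
have E z p : z / m / a p = z / b p * (b p / (m * a p)).
  by rewrite [RHS]mulrA divfK ?b0 // invfM mulrA.
exists (x / m), (y / m); split; first by rewrite mulf_neq0 ?invr_eq0.
move=> p; rewrite !E; have [_ Obm _] := bu p.
have [xp|xp] := pselect (prime_set p x).
  have yp : Oloc_unit p (y / b p).
    by apply: yP; rewrite mem_undup -[is_true _]/([set` C] p) -CE.
  split; [|by case: yp => _ ? _; exact: OlocM|by right; exact: Oloc_unitM].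
  by apply: OlocM => //; exact: OF_Oloc.
have xu := Oloc_unit_notp Ox xp.
have bxu : Oloc_unit p (x / b p).
  apply: Oloc_unit_notp => // pxb; apply: xp.
  by rewrite -(divfK (b0 p) x); exact: prime_setMl.
split; [by case: bxu => _ ? _; exact: OlocM| |by left; exact: Oloc_unitM].
apply: OlocM => //.
have -> : y / b p = y * (x / b p) / x by rewrite mulrA mulrAC mulfK.
by case: xu => _ _ xV; apply: OlocM => //; apply/OF_Oloc/OF_mul.
Qed.

End IdealGenerators.

(** * Completions *)

Section Completion.
Variables (F : fieldExtType rat) (p : prime_ideal F).
Implicit Types (s r : cauchyType p) (x a : F) (t : Fp p).

Definition piF (s : cauchyType p) : Fp p := \pi_(Fp p)%qT s.

Lemma piFM s r : piF (s * r) = piF s * piF r.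
Proof. exact: (rmorphM \pi_(Fp p)%qT). Qed.

Lemma piFB s r : piF (s - r) = piF s - piF r.
Proof. exact: (rmorphB \pi_(Fp p)%qT). Qed.

Lemma piF1 : piF 1 = 1.
Proof. exact: (rmorph1 \pi_(Fp p)%qT). Qed.

Lemma piF_surj t : exists s, piF s = t.
Proof. by exists (repr t); rewrite /piF reprK. Qed.

Lemma Fp_ofE x : Fp_of p x = piF (CauchySeq (cauchy_const p x)).
Proof. by []. Qed.

Lemma piF_eq s r : piF s = piF r <->
  cvg0 p (fun i => cauchy_val s i - cauchy_val r i).
Proof.
split=> [/eqP|sr].
  by rewrite -Quotient.idealrBE => /asboolP.
by apply/eqP; rewrite -Quotient.idealrBE; apply/asboolP.
Qed.

Lemma Fp_of_unit x : x != 0 -> Fp_of p x \is a GRing.unit.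
Proof. by move=> x0; rewrite rmorph_unit // unitfE. Qed.

(** Replacing the first [N] terms by 0 leaves the class of the sequence unchanged. *)
Lemma Op_eventually s N : (forall i, (N <= i)%N -> Oloc p (cauchy_val s i)) ->
  Op (piF s).
Proof.
move=> sN; pose f i := if (N <= i)%N then cauchy_val s i else 0.
have cf : f \in @cauchy_seq F p.
  apply/asboolP => d d0; have [M cM] := asboolP _ (cauchy_valP s) d d0.
  exists (maxn N M) => i j; rewrite !geq_max => /andP[Ni Mi] /andP[Nj Mj].
  by rewrite /f Ni Nj; exact: cM.
exists (CauchySeq cf); split=> [i /=|].
  by rewrite /f; case: ifP => // ?; [exact: sN|exact: Oloc0].
apply/piF_eq => d d0; exists N => i Ni /=.
by rewrite /f Ni subrr mul0r; exact: Oloc0.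
Qed.

Lemma Op_of x : Oloc p x -> Op (Fp_of p x).
Proof. by move=> Ox; exists (CauchySeq (cauchy_const p x)). Qed.

Lemma OpB t u : Op t -> Op u -> Op (t - u).
Proof.
move=> [s [Os ->]] [r [Or ->]]; rewrite -piFB.
by apply: (@Op_eventually _ 0) => i _; exact: (OlocB (Os i) (Or i)).
Qed.

Lemma OpM t u : Op t -> Op u -> Op (t * u).
Proof.
move=> [s [Os ->]] [r [Or ->]]; rewrite -piFM.
by apply: (@Op_eventually _ 0) => i _; exact: (OlocM (Os i) (Or i)).
Qed.

Lemma Op0 : Op (0 : Fp p).
Proof. by rewrite -(rmorph0 (Fp_of p)); apply/Op_of/Oloc0. Qed.

Lemma Op1 : Op (1 : Fp p).
Proof. by rewrite -(rmorph1 (Fp_of p)); apply/Op_of/Oloc1. Qed.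

Lemma OpD t u : Op t -> Op u -> Op (t + u).
Proof.
move=> Ot Ou; rewrite -[u]opprK; apply: OpB => //.
by rewrite -sub0r; apply: OpB => //; exact: Op0.
Qed.

Lemma Op_sum (I : Type) (R : seq I) (P : pred I) (f : I -> Fp p) :
  (forall i, P i -> Op (f i)) -> Op (\sum_(i <- R | P i) f i).
Proof. by move=> ?; apply: big_ind => //; [exact: Op0|exact: OpD]. Qed.

Lemma Op_prod (I : Type) (R : seq I) (P : pred I) (f : I -> Fp p) :
  (forall i, P i -> Op (f i)) -> Op (\prod_(i <- R | P i) f i).
Proof. by move=> ?; apply: big_ind => //; [exact: Op1|exact: OpM]. Qed.

Lemma Op_det n (A : 'M[Fp p]_n) : (forall i j, Op (A i j)) -> Op (\det A).
Proof.
move=> OA; apply: Op_sum => s _; apply: OpM; last exact: Op_prod.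
rewrite -signr_odd; case: odd; rewrite ?expr1 ?expr0; last exact: Op1.
by rewrite -sub0r; apply: OpB; [exact: Op0|exact: Op1].
Qed.

(** A late term of a sequence in [Oloc p] representing [x] differs from [x] by an element of
    [Oloc p]. *)
Lemma Op_of_Oloc x : Op (Fp_of p x) -> Oloc p x.
Proof.
move=> [s [Os /piF_eq/(_ 1 (oner_neq0 _))[N /(_ N (leqnn N))]]] /=.
by rewrite divr1 => Oxs; rewrite -[x](subrK (cauchy_val s N)); exact: OlocD.
Qed.

Lemma Op_unitM t u : Op_unit t -> Op_unit u -> Op_unit (t * u).
Proof.
move=> [Ut Ot Ot'] [Uu Ou Ou']; split; [by rewrite unitrM Ut|exact: OpM|].
by rewrite invrM // mulrC; exact: OpM.
Qed.

Lemma Op_unitV t : Op_unit t -> Op_unit t^-1.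
Proof. by case=> *; split; rewrite ?unitrV ?invrK. Qed.

Lemma Op_unit1 : Op_unit (1 : Fp p).
Proof. by split; rewrite ?unitr1 ?invr1 //; exact: Op1. Qed.

Lemma Op_unit_of x : Oloc_unit p x -> Op_unit (Fp_of p x).
Proof.
move=> [x0 Ox Ox']; split; [exact: Fp_of_unit|exact: Op_of|].
by rewrite -fmorphV; exact: Op_of.
Qed.

Lemma Oloc_unit_of x : x != 0 -> Op_unit (Fp_of p x) -> Oloc_unit p x.
Proof.
move=> x0 [_ Ox Ox']; split=> //; apply: Op_of_Oloc => //.
by rewrite fmorphV.
Qed.

(** A late term of a Cauchy sequence [s] representing [t] serves as [a], since the quotients of late
    terms of [s] are local units. *)
Lemma Fp_unit_approx t : t \is a GRing.unit ->
  exists2 a : F, a != 0 & Op_unit (t / Fp_of p a).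
Proof.
move=> Ut; have [s sE] := piF_surj t.
have [r rE] := piF_surj t^-1.
have /piF_eq sr1 : piF (s * r) = piF 1.
  by rewrite piFM piF1 sE rE divrr.
have [e e0 [N1 Oer]] := cauchy_bounded (asboolP _ (cauchy_valP r)).
(* Late products [s_i * r_i] differ from 1 by a multiple of [z], an element of [p], and so are local
   units. *)
have [z pz z0] := prime_nz p.
have [N2 ON2] := sr1 z z0.
have [N3 ON3] := asboolP _ (cauchy_valP s) e e0.
pose N := maxn N1 (maxn N2 N3).
have usr i : (N <= i)%N -> Oloc_unit p (cauchy_val s i * cauchy_val r i).
  rewrite !geq_max => /and3P[_ /ON2 iN2 _].
  have := Oloc_unitD (OF_nat F 1) (@prime1 _ p) pz iN2.
  by rewrite mulrC divfK //= addrC subrK.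
have s0 i : (N <= i)%N -> cauchy_val s i != 0.
  by move/usr => [+ _ _]; rewrite mulf_eq0 negb_or => /andP[].
have Oss i j : (N <= i)%N -> (N <= j)%N -> Oloc p (cauchy_val s i / cauchy_val s j).
  move=> Ni Nj; have [_ _ Osr] := usr j Nj; have sj0 := s0 j Nj.
  have rj0 : cauchy_val r j != 0.
    by have [+ _ _] := usr j Nj; rewrite mulf_eq0 negb_or => /andP[].
  move: Ni Nj; rewrite !geq_max => /and3P[i1 i2 i3] /and3P[j1 j2 j3].
  (* Here [e] bounds the denominators of [r], the difference [s_i - s_j] is divisible by [e], and
     [s_j * r_j] is a unit. *)
  have -> : cauchy_val s i / cauchy_val s j = 1 +
      (cauchy_val s i - cauchy_val s j) / e * (e * cauchy_val r j) *
      (cauchy_val s j * cauchy_val r j)^-1.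
    rewrite mulrA divfK // invfM mulrACA divff // mulr1.
    by rewrite mulrBl divff // addrC subrK.
  apply: OlocD; first exact: Oloc1.
  by apply: OlocM => //; apply: OlocM; [exact: ON3|exact: Oer].
exists (cauchy_val s N); first exact: s0.
have sN0 := s0 N (leqnn N).
split; first by rewrite unitrM Ut unitrV Fp_of_unit.
  have -> : t / Fp_of p (cauchy_val s N) =
      piF (s * CauchySeq (cauchy_const p (cauchy_val s N)^-1)).
    by rewrite piFM sE -Fp_ofE fmorphV.
  apply: (@Op_eventually _ N) => i Ni.
  exact: Oss.
rewrite invrM ?unitrV ?Fp_of_unit // invrK mulrC -rE Fp_ofE -piFM.
apply: (@Op_eventually _ N) => i Ni.
rewrite [X in Oloc p X](_ : _ = (cauchy_val s i * cauchy_val r i) *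
  (cauchy_val s N / cauchy_val s i)).
  by apply: OlocM; [case: (usr i Ni)|exact: Oss].
by rewrite [cauchy_val s i * _]mulrC mulrACA divff ?s0 // mulr1.
Qed.

End Completion.

(** * Quadratic forms and their Hessians *)

Section PolarForm.
Variables (K : comNzRingType) (M : lmodType K) (Q : M -> K).
Hypothesis Qq : quadratic_form Q.
Implicit Types (u v w : M).

Lemma polarC u v : polar Q u v = polar Q v u.
Proof. by rewrite /polar [u + v]addrC addrAC. Qed.

Lemma polarvv u : polar Q u u = Q u *+ 2.
Proof.
have -> : polar Q u u = Q (2%:R *: u) - Q u - Q u by rewrite scaler_nat mulr2n.
by rewrite Qq.1; ring.
Qed.

Lemma polarDl u v w : polar Q (u + v) w = polar Q u w + polar Q v w.
Proof. by rewrite -[u]scale1r [LHS]Qq.2 mul1r scale1r. Qed.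

Lemma polar0l w : polar Q 0 w = 0.
Proof. by apply: (addrI (polar Q 0 w)); rewrite -polarDl !addr0. Qed.

Lemma polarZl a u w : polar Q (a *: u) w = a * polar Q u w.
Proof. by rewrite -[a *: u]addr0 [LHS]Qq.2 polar0l addr0. Qed.

Lemma polarZr a u w : polar Q w (a *: u) = a * polar Q w u.
Proof. by rewrite polarC polarZl polarC. Qed.

Lemma polar_suml (I : finType) (f : I -> M) w :
  polar Q (\sum_i f i) w = \sum_i polar Q (f i) w.
Proof.
apply: (big_morph (polar Q ^~ w)); last exact: polar0l.
by move=> u v; exact: polarDl.
Qed.

Lemma polar_sumr (I : finType) (f : I -> M) w :
  polar Q w (\sum_i f i) = \sum_i polar Q w (f i).
Proof. by rewrite polarC polar_suml; apply: eq_bigr => i _; rewrite polarC. Qed.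

Definition gram n (b : 'I_n -> M) : 'M[K]_n := \matrix_(i, j) polar Q (b i) (b j).

Lemma gram_change m n (b : 'I_m -> M) (C : 'M[K]_(n, m)) :
  gram (fun i => \sum_k C i k *: b k) = C *m gram b *m C^T.
Proof.
apply/matrixP => i j; rewrite !mxE polar_sumr; apply: eq_bigr => k _.
rewrite polarZr polar_suml !mxE mulrC; congr (_ * _).
by apply: eq_bigr => l _; rewrite polarZl mxE.
Qed.

End PolarForm.

(* The polar form of [\sum_i A i * x_i ^+ 2 + \sum_(i < j) B i j * (x_i * x_j)]. *)
Definition polar_expr (K : comNzRingType) n (A : 'I_n -> K) (B : 'I_n -> 'I_n -> K)
    (x y : 'I_n -> K) : K :=
  \sum_(i < n) A i * (x i * y i *+ 2) +
  \sum_(i < n) \sum_(j < n | (i < j)%N) B i j * (x i * y j + y i * x j).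

Section FormPoly.
Variables (K : comNzRingType) (n : nat).

(** Both the coordinates of the [i]-th unit vector and the derivatives of the indeterminates with
    respect to ['X_i]. *)
Definition delta_fun (i k : 'I_n) : K := (k == i)%:R.

Lemma sum_lt_delta (B : 'I_n -> 'I_n -> K) (a b : 'I_n) :
  \sum_(i < n) \sum_(j < n | (i < j)%N) B i j * (delta_fun a i * delta_fun b j) =
  if (a < b)%N then B a b else 0.
Proof.
rewrite (bigD1 a) //= [X in _ + X]big1 ?addr0; last first.
  move=> i /negPf ia; apply: big1 => j _.
  by rewrite /delta_fun ia mul0r mulr0.
rewrite big_mkcond (bigD1 b) //= [X in _ + X]big1 ?addr0; last first.
  by move=> j /negPf jb; rewrite /delta_fun jb !mulr0 if_same.
by rewrite /delta_fun !eqxx !mulr1.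
Qed.

Lemma polar_expr_delta (A : 'I_n -> K) B (a b : 'I_n) :
  polar_expr A B (delta_fun a) (delta_fun b) =
  if (a < b)%N then B a b else if (b < a)%N then B b a else A a *+ 2.
Proof.
rewrite /polar_expr.
under [X in _ + X]eq_bigr => i _ do under eq_bigr => j _ do rewrite mulrDr.
under [X in _ + X]eq_bigr => i _ do rewrite big_split.
rewrite big_split /= !sum_lt_delta (bigD1 a) //= big1 ?addr0; last first.
  by move=> i /negPf ia; rewrite /delta_fun ia mul0r mul0rn mulr0.
rewrite /delta_fun eqxx mul1r; have [ab|ba|/val_inj ->] := ltngtP a b.
- by rewrite -val_eqE /= ltn_eqF // mul0rn mulr0 add0r addr0.
- by rewrite -val_eqE /= gtn_eqF // mul0rn mulr0 !add0r.
- by rewrite eqxx !addr0 mulrnAr mulr1.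
Qed.

Variables (M : lmodType K) (Q : M -> K).
Hypothesis Qq : quadratic_form Q.

Lemma polar_expr_polar (b : 'I_n -> M) (i j : 'I_n) :
  polar_expr (fun k => Q (b k)) (fun k l => polar Q (b k) (b l))
    (delta_fun i) (delta_fun j) = polar Q (b i) (b j).
Proof.
rewrite polar_expr_delta; have [//|_|/val_inj ->] := ltngtP i j.
  exact: polarC.
by rewrite polarvv.
Qed.

Lemma mderivXU (i k : 'I_n) : mderiv i ('X_k : {mpoly K[n]}) = (delta_fun i k)%:MP.
Proof.
rewrite mderivX mnmE /delta_fun; case: eqP => [->|_]; last by rewrite scale0r.
rewrite scale1r (_ : (_ - _)%MM = 0%MM) ?mpolyX0 //.
by apply/mnmP => l; rewrite mnmBE subnn mnm0E.
Qed.

(** By the product rule, a second derivative of ['X_k * 'X_l] is its polarization at two unit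
    vectors, so each entry is [polar_expr] at [delta_fun i] and [delta_fun j]. *)
Lemma hessian_form_poly (b : 'I_n -> M) : hessian (form_poly Q b) = gram Q b.
Proof.
apply/matrixP => i j; rewrite !mxE -polar_expr_polar /form_poly /polar_expr.
rewrite !raddfD /=; congr (_ + _).
  rewrite (raddf_sum (mderiv j)) (raddf_sum (mderiv i)) (raddf_sum (meval _)).
  apply: eq_bigr => k _ /=.
  rewrite !mderivZ mevalZ expr2 !mderivM !mderivXU; congr (_ * _).
  rewrite !mderivD !mderivM !mderivXU !mderivC !mevalD !mevalM !mevalC mevalXU.
  ring.
rewrite (raddf_sum (mderiv j)) (raddf_sum (mderiv i)) (raddf_sum (meval _)).
apply: eq_bigr => k _ /=.
rewrite (raddf_sum (mderiv j)) (raddf_sum (mderiv i)) (raddf_sum (meval _)).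
apply: eq_bigr => l _ /=.
rewrite !mderivZ mevalZ !mderivM !mderivXU; congr (_ * _).
rewrite !mderivD !mderivM !mderivXU !mderivC !mevalD !mevalM !mevalC !mevalXU.
ring.
Qed.

End FormPoly.

(** * Extension of scalars for quadratic forms *)

Section BaseChange.
Variables (K R : comNzRingType) (f : {rmorphism K -> R}) (n : nat).
Variables (M : lmodType K) (Q : M -> K).
Hypothesis Qq : quadratic_form Q.
Variable b : 'I_n -> M.

(** [loc_form] is the case where [f] is [Fp_of p] and [b] is [vbasis]. *)
Definition form_ext (w : 'rV[R]_n) : R :=
  meval (fun i => w 0 i) (map_mpoly f (form_poly Q b)).

Let A i := f (Q (b i)).
Let B i j := f (polar Q (b i) (b j)).

Lemma form_extE w : form_ext w = \sum_(i < n) A i * w 0 i ^+ 2 +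
  \sum_(i < n) \sum_(j < n | (i < j)%N) B i j * (w 0 i * w 0 j).
Proof.
rewrite /form_ext /form_poly !rmorphD /=; congr (_ + _).
  rewrite (raddf_sum (map_mpoly f)) (raddf_sum (meval _)); apply: eq_bigr => i _ /=.
  by rewrite map_mpolyZ mevalZ !rmorphXn /= map_mpolyX mevalXU.
rewrite (raddf_sum (map_mpoly f)) (raddf_sum (meval _)); apply: eq_bigr => i _ /=.
rewrite (raddf_sum (map_mpoly f)) (raddf_sum (meval _)); apply: eq_bigr => j _ /=.
by rewrite map_mpolyZ mevalZ !rmorphM /= !map_mpolyX !mevalXU.
Qed.

Lemma polar_form_extE v w :
  polar form_ext v w = polar_expr A B (fun i => v 0 i) (fun i => w 0 i).
Proof.
rewrite /polar !form_extE /polar_expr opprD addrACA -!sumrB opprD addrACA -!sumrB.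
congr (_ + _); apply: eq_bigr => i _; first by rewrite !mxE; ring.
by rewrite -!sumrB; apply: eq_bigr => j _; rewrite !mxE; ring.
Qed.

Lemma form_ext_quadratic : quadratic_form form_ext.
Proof.
split=> [a w|v a u w].
  rewrite !form_extE mulrDr !mulr_sumr; congr (_ + _); apply: eq_bigr => i _.
    by rewrite mxE; ring.
  by rewrite mulr_sumr; apply: eq_bigr => j _; rewrite !mxE; ring.
rewrite !polar_form_extE /polar_expr mulrDr addrACA !mulr_sumr -!big_split /=.
apply: eq_bigr => i _; congr (_ + _); first by rewrite !mxE; ring.
by rewrite mulr_sumr -big_split /=; apply: eq_bigr => j _; rewrite !mxE; ring.
Qed.

Lemma polar_form_ext_delta i j :
  polar form_ext (delta_mx 0 i) (delta_mx 0 j) = f (polar Q (b i) (b j)).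
Proof.
rewrite polar_form_extE.
have dE k : (fun i => (delta_mx 0 k : 'rV[R]_n) 0 i) = delta_fun R k.
  by apply/funext => l; rewrite mxE eqxx.
rewrite !dE polar_expr_delta /A /B; have [//|_|/val_inj ->] := ltngtP i j.
  by rewrite polarC.
by rewrite polarvv // rmorphMn.
Qed.

End BaseChange.

(** * Lattices *)

Lemma sqcl_atP (F : fieldExtType rat) (S : SqCl F) (s : finite_idele F)
    (p : prime_ideal F) (d : Fp p) : sqcl_set S = idele_coset s ->
  sqcl_at S p d <-> exists2 u, Op_unit u & d = s p * u ^+ 2.
Proof.
move=> SE; split=> [[t]|[u Uu dE]].
  by rewrite SE => -[u Uu tE] <-; exists (u p).
(* Multiplying [s] by the square of the unit idele with component [u] at [p] and 1 elsewhere gives a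
   member of the class with the prescribed component. *)
pose v := dfwith (fun q => 1 : Fp q) u.
have Uv q : Op_unit (v q).
  have [pq|pq] := eqVneq p q; first by subst q; rewrite /v dfwith_in.
  by rewrite /v dfwith_out //; exact: Op_unit1.
pose w q := s q * v q ^+ 2.
have w_unit q : w q \is a GRing.unit.
  by rewrite unitrM idele_unit unitrX //; case: (Uv q).
have w_fin : finite_set [set q | ~ Op_unit (w q)].
  apply: sub_finite_set (idele_fin s) => q /= nw Us; apply: nw.
  by rewrite /w expr2; do 2!apply: Op_unitM => //.
exists (FiniteIdele w_unit w_fin); first by rewrite SE; exists v.
by rewrite /= /w dE /v dfwith_in.
Qed.

Section LocalLattice.
Variables (F : fieldExtType rat) (n : nat) (L : quad_lattice F n).
Variable p : prime_ideal F.
Notation V := (qspace L).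
Notation e := (vbasis {: V}).
Notation f := (@loc_form F n L p).

Lemma loc_form_quadratic : quadratic_form f.
Proof. exact: (form_ext_quadratic (Fp_of p)). Qed.

Lemma polar_loc_form_delta i j :
  polar f (delta_mx 0 i) (delta_mx 0 j) = Fp_of p (polar (qform L) (tnth e i) (tnth e j)).
Proof. exact: (polar_form_ext_delta (Fp_of p) (qformP L)). Qed.

Lemma loc_vecE (v : V) : loc_vec p v = \sum_i Fp_of p (coord e i v) *: delta_mx 0 i.
Proof. by rewrite [LHS]row_sum_delta; apply: eq_bigr => i _; rewrite mxE. Qed.

Lemma loc_vecD (u v : V) : loc_vec p (u + v) = loc_vec p u + loc_vec p v.
Proof. by apply/rowP => i; rewrite !mxE linearD rmorphD. Qed.

Lemma loc_vecZ a (v : V) : loc_vec p (a *: v) = Fp_of p a *: loc_vec p v.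
Proof. by apply/rowP => i; rewrite !mxE linearZ rmorphM. Qed.

Lemma loc_vec_sum (I : finType) (v : I -> V) :
  loc_vec p (\sum_i v i) = \sum_i loc_vec p (v i).
Proof.
apply: (big_morph (loc_vec p)) => [u v'|]; first exact: loc_vecD.
by apply: (addrI (loc_vec p 0)); rewrite -loc_vecD !addr0.
Qed.

Lemma polar_loc_vec (u v : V) :
  polar f (loc_vec p u) (loc_vec p v) = Fp_of p (polar (qform L) u v).
Proof.
have Qq := qformP L; have fq := loc_form_quadratic.
rewrite {2}(coord_vbasis (memvf u)) {2}(coord_vbasis (memvf v)) !loc_vecE.
rewrite !polar_suml // rmorph_sum; apply: eq_bigr => i _.
rewrite !polarZl // rmorphM; congr (_ * _).
rewrite !polar_sumr // rmorph_sum; apply: eq_bigr => j _.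
rewrite !polarZr // rmorphM; congr (_ * _).
by rewrite polar_loc_form_delta !(tnth_nth 0).
Qed.

Lemma gram_loc_vec m (v : 'I_m -> V) :
  gram f (fun i => loc_vec p (v i)) = map_mx (Fp_of p) (gram (qform L) v).
Proof. by apply/matrixP => i j; rewrite !mxE polar_loc_vec. Qed.

(** Two [Op]-bases of the local lattice differ by a matrix invertible over [Op], which changes the
    Gram determinant by the square of a unit. *)
Lemma detH_at_basis (b : 'I_n -> loc_space L p) (d : Fp p) :
    is_basis (@Op F p) (loc_lattice (L := L) (p := p)) b ->
  detH_at L p d <-> exists2 u, Op_unit u & d = \det (gram f b) * u ^+ 2.
Proof.
have fq := loc_form_quadratic.
move=> bb; split=> [[b' [u [bb' Uu ->]]]|[u Uu ->]]; last first.
  by exists b, u; split=> //; rewrite hessian_form_poly.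
have change (b1 b2 : 'I_n -> loc_space L p) :
    is_basis (@Op F p) (loc_lattice (L := L) (p := p)) b1 ->
    is_basis (@Op F p) (loc_lattice (L := L) (p := p)) b2 ->
    exists2 C : 'M_n, forall i j, Op (C i j) & forall i, b2 i = \sum_j C i j *: b1 j.
  move=> [s1 _] [s2 _].
  have /choice[c cP] i : exists c : 'I_n -> Fp p,
      (forall j, Op (c j)) /\ b2 i = \sum_j c j *: b1 j.
    have /s1[c Oc E] : loc_lattice (b2 i); last by exists c.
    apply/s2; exists (fun j => (j == i)%:R).
      by move=> j; case: eqP => _; [exact: Op1|exact: Op0].
    by rewrite (bigD1 i) //= eqxx scale1r big1 ?addr0 // => j /negPf->; rewrite scale0r.
  exists (\matrix_(i, j) c i j) => [i j|i]; rewrite ?mxE; first by case: (cP i).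
  by have [_ ->] := cP i; apply: eq_bigr => j _; rewrite mxE.
have [C OC CE] := change _ _ bb bb'; have [D OD DE] := change _ _ bb' bb.
have DC1 : D *m C = 1%:M.
  apply/matrixP => i j; apply/eqP; rewrite -subr_eq0; apply/eqP.
  (* Row [i] of [D *m C - 1%:M] consists of the coefficients, all in [Op], of a linear relation
     between the [b k]. *)
  have [_ /(_ (fun k => (D *m C) i k - 1%:M i k))] := bb; apply=> [k|].
    apply: OpB; last by rewrite mxE; case: eqP => _; [exact: Op1|exact: Op0].
    by rewrite mxE; apply: Op_sum => l _; exact: OpM.
  under eq_bigr => k _ do rewrite scalerBl.
  rewrite sumrB; apply/eqP; rewrite subr_eq0; apply/eqP.
  rewrite [RHS](bigD1 i) //= [X in _ = _ + X]big1 ?addr0; last first.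
    by move=> k ki; rewrite mxE eq_sym (negPf ki) scale0r.
  rewrite mxE eqxx scale1r DE.
  under eq_bigr => k _ do rewrite mxE scaler_suml.
  rewrite exchange_big /=; apply: eq_bigr => l _.
  by rewrite CE scaler_sumr; apply: eq_bigr => k _; rewrite scalerA.
have UC : Op_unit (\det C).
  have dDC : \det D * \det C = 1 by rewrite -det_mulmx DC1 det1.
  have UC : \det C \is a GRing.unit by apply/unitrPr; exists (\det D); rewrite mulrC.
  split=> //; first exact: Op_det.
  by rewrite -[_^-1]mul1r -dDC mulrK //; exact: Op_det.
exists (\det C * u); first exact: Op_unitM.
rewrite hessian_form_poly // (_ : b' = fun i => \sum_k C i k *: b k); last first.
  by apply/funext => i; exact: CE.
by rewrite gram_change // !det_mulmx det_tr; ring.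
Qed.

(** Reduces the local basis property to computations over [F]: spanning is tested on the generators
    [g], independence on the Gram determinant. *)
Lemma loc_lattice_basis (g : seq V) (v : 'I_n -> V) :
    lattice L = lspan (@OF F) [set w | w \in g] ->
    (forall i, lattice L (v i)) ->
    (forall w, w \in g -> exists2 c : 'I_n -> F,
       forall i, Oloc p (c i) & w = \sum_i c i *: v i) ->
    \det (gram (qform L) v) != 0 ->
  is_basis (@Op F p) (loc_lattice (L := L) (p := p)) (fun i => loc_vec p (v i)).
Proof.
move=> gE Lv gv dG; split=> [w|c Oc c0]; last first.
  pose r := \row_i c i.
  suff r0 : r = 0 by move=> i; have := congr1 (fun r : 'rV_n => r 0 i) r0; rewrite !mxE.
  (* Pairing a relation with every [v j] shows that its row of coefficients is killed by the Gram
     matrix, which is invertible over [Fp p]. *)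
  have U : map_mx (Fp_of p) (gram (qform L) v) \in unitmx.
    by rewrite unitmxE det_map_mx Fp_of_unit.
  rewrite -(mulmxK U r) (_ : r *m _ = 0) ?mul0mx //.
  apply/rowP => j; rewrite !mxE -[RHS](polar0l loc_form_quadratic (loc_vec p (v j))) -c0.
  rewrite polar_suml; last exact: loc_form_quadratic.
  apply: eq_bigr => i _; rewrite polarZl; last exact: loc_form_quadratic.
  by rewrite !mxE polar_loc_vec.
split=> [[k [c [x [Oc xL ->]]]]|[c Oc ->]]; last first.
  by exists n, c, (fun i => loc_vec p (v i)); split=> // i; exists (v i).
have comb w' : lattice L w' -> exists2 c : 'I_n -> F,
    forall i, Oloc p (c i) & w' = \sum_i c i *: v i.
  rewrite gE => -[m [a [y [Oa yg ->]]]].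
  have /choice[d dP] j : exists d : 'I_n -> F,
      (forall i, Oloc p (d i)) /\ y j = \sum_i d i *: v i.
    by have [d Od E] := gv _ (yg j); exists d.
  exists (fun i => \sum_j a j * d j i).
    move=> i; apply: big_ind => [|? ?|j _]; [exact: Oloc0|exact: OlocD|].
    by apply: OlocM; [exact: OF_Oloc|case: (dP j)].
  under [RHS]eq_bigr => i _ do rewrite scaler_suml.
  rewrite exchange_big /=; apply: eq_bigr => j _; have [_ ->] := dP j.
  by rewrite scaler_sumr; apply: eq_bigr => i _; rewrite scalerA.
have /choice[d dP] j : exists d : 'I_n -> F,
    (forall i, Oloc p (d i)) /\ x j = \sum_i Fp_of p (d i) *: loc_vec p (v i).
  have [w' /comb[d Od ->] <-] := xL j; exists d; split=> //.
  by rewrite loc_vec_sum; apply: eq_bigr => i _; rewrite loc_vecZ.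
exists (fun i => \sum_j c j * Fp_of p (d j i)).
  by move=> i; apply: Op_sum => j _; apply: OpM => //; apply: Op_of; case: (dP j).
under [RHS]eq_bigr => i _ do rewrite scaler_suml.
rewrite exchange_big /=; apply: eq_bigr => j _; have [_ ->] := dP j.
by rewrite scaler_sumr; apply: eq_bigr => i _; rewrite scalerA.
Qed.

End LocalLattice.

Lemma gram_vbasis_neq0 (F : fieldExtType rat) (V : vectType F) (Q : V -> F) :
    quadratic_form Q -> nondegenerate_form Q ->
  \det (gram Q (tnth (vbasis {: V}))) != 0.
Proof.
move=> Qq nd; apply/negP => /det0P[r r0 rG].
pose u := \sum_i r 0 i *: tnth (vbasis {: V}) i.
have u0 : u = 0.
  apply: nd => v; rewrite (coord_vbasis (memvf v)) polar_sumr //.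
  apply: big1 => j _; rewrite polarZr // /u polar_suml //.
  have := congr1 (fun r : 'rV_(\dim {: V}) => r 0 j) rG; rewrite !mxE => E.
  rewrite -[RHS](mulr0 (coord (vbasis {: V}) j v)) -[in RHS]E; congr (_ * _).
  by apply: eq_bigr => i _; rewrite polarZl // mxE (tnth_nth 0 _ j).
move/eqP: r0; apply; apply/rowP => i; rewrite mxE.
have /freeP := basis_free (vbasisP {: V}); apply.
by apply: etrans u0; apply: eq_bigr => k _; rewrite (tnth_nth 0).
Qed.

(** Bridges the matrix sizes [\dim {: V}] and [n], which are equal but not convertible. *)
Lemma det_cast_ord (R : comNzRingType) m n (mn : m = n) (A : 'M[R]_m) :
  \det (\matrix_(i < n, j < n) A (cast_ord (esym mn) i) (cast_ord (esym mn) j)) = \det A.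
Proof.
by case: _ / mn; congr (\det _); apply/matrixP => i j; rewrite mxE !cast_ord_id.
Qed.

Lemma detH_at_rational (F : fieldExtType rat) n (L : quad_lattice F n) :
    nondegenerate_form (qform L) ->
  exists2 a : F, a != 0 &
    forall (p : prime_ideal F) d, detH_at L p d -> exists t, d = Fp_of p a * t ^+ 2.
Proof.
move=> nd; have dV := qspace_dim L.
exists (\det (gram (qform L) (tnth (vbasis {: qspace L})))).
  exact: gram_vbasis_neq0 (qformP L) nd.
move=> p d [b [u [_ _ ->]]]; have fq := loc_form_quadratic L p.
(* The image of the global basis [vbasis], reindexed by ['I_n] so that the coordinate matrix of [b]
   is square. *)
pose D : 'I_n -> loc_space L p := fun i => delta_mx 0 (cast_ord (esym dV) i).
have bE : b = fun i => \sum_k (\matrix_(i, k) b i 0 (cast_ord (esym dV) k)) i k *: D k.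
  apply/funext => i; rewrite [LHS]row_sum_delta (reindex (cast_ord (esym dV))) /=.
    by apply: eq_bigr => k _; rewrite mxE.
  by exists (cast_ord dV) => k _; rewrite ?cast_ordK ?cast_ordKV.
rewrite hessian_form_poly // bE gram_change // !det_mulmx det_tr.
set C := \matrix_(i, k) _; exists (\det C * u).
suff -> : \det (gram (@loc_form F n L p) D) =
    Fp_of p (\det (gram (qform L) (tnth (vbasis {: qspace L})))) by ring.
rewrite -det_map_mx -(det_cast_ord dV); congr (\det _).
by apply/matrixP => i j; rewrite !mxE polar_loc_form_delta.
Qed.

(** * Diagonal forms on lattices with one ideal coefficient *)

Section DiagonalLattice.
Variables (F : fieldExtType rat) (n : nat).

(** The division by 2 makes the Gram matrix of the standard basis the diagonal matrix of [c]. *)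
Definition diag_form (c : 'I_n -> F) (v : 'rV[F]_n) : F :=
  \sum_i c i / 2%:R * v 0 i ^+ 2.

Lemma two_neq0 : 2%:R != 0 :> F.
Proof. by rewrite -[2%:R]/((2 : int)%:~R) int_eq0. Qed.

Lemma polar_diag_form c u v :
  polar (diag_form c) u v = \sum_i c i * (u 0 i * v 0 i).
Proof.
rewrite /polar /diag_form -!sumrB; apply: eq_bigr => i _.
by rewrite !mxE; field; exact: two_neq0.
Qed.

Lemma diag_form_quadratic c : quadratic_form (diag_form c).
Proof.
split=> [a v|v a u w].
  by rewrite /diag_form mulr_sumr; apply: eq_bigr => i _; rewrite mxE; ring.
rewrite !polar_diag_form mulr_sumr -big_split /=; apply: eq_bigr => i _.
by rewrite !mxE; ring.
Qed.

Lemma polar_diag_delta c k v :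
  polar (diag_form c) v (delta_mx 0 k) = c k * v 0 k.
Proof.
rewrite polar_diag_form (bigD1 k) //= mxE !eqxx mulr1 big1 ?addr0 // => i /negPf ik.
by rewrite mxE ik andbF !mulr0.
Qed.

Lemma diag_form_nondegenerate c : (forall i, c i != 0) ->
  nondegenerate_form (diag_form c).
Proof.
move=> c0 u uv; apply/rowP => k; rewrite mxE; apply: (mulfI (c0 k)).
by rewrite -polar_diag_delta uv mulr0.
Qed.

Lemma gram_diag_form c (k : 'I_n -> F) :
  \det (gram (diag_form c) (fun i => k i *: delta_mx 0 i)) = \prod_i (c i * k i ^+ 2).
Proof.
have -> : gram (diag_form c) (fun i => k i *: delta_mx 0 i) =
    diag_mx (\row_i (c i * k i ^+ 2)).
  apply/matrixP => i j; rewrite !mxE (polarZr (diag_form_quadratic c)).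
  rewrite polar_diag_delta !mxE eqxx /=.
  by rewrite eq_sym; case: eqP => [->|_]; rewrite ?mulr1n ?mulr0n; ring.
by rewrite det_diag; apply: eq_bigr => i _; rewrite mxE.
Qed.

(** Generators of the direct sum of the fractional ideal of [x] and [y] on the axis [o] and of
    copies of [OF] on the other axes. *)
Definition ideal_gens (o : 'I_n) (x y : F) : seq 'rV[F]_n :=
  x *: delta_mx 0 o :: y *: delta_mx 0 o :: [seq delta_mx 0 i | i <- enum 'I_n & i != o].

Lemma ideal_gens_full o x y : x != 0 ->
  lspan setT (lspan (@OF F) [set v | v \in ideal_gens o x y]) = setT.
Proof.
move=> x0; apply/seteqP; split=> // v _.
pose k i := if i == o then x else 1.
exists n, (fun i => v 0 i / k i), (fun i => k i *: delta_mx 0 i); split=> //.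
  move=> i; exists 1%N, (fun=> 1), (fun=> k i *: delta_mx 0 i); split.
  - by move=> _; exact: (OF_nat F 1).
  - move=> _ /=; rewrite /k !inE; have [->|io] := eqVneq i o; rewrite ?eqxx //.
    by rewrite /= scale1r map_f ?orbT // mem_filter io mem_enum.
  - by rewrite big_ord1 scale1r.
rewrite [LHS]row_sum_delta; apply: eq_bigr => i _; rewrite scalerA divfK //.
by rewrite /k; case: ifP; rewrite ?oner_neq0.
Qed.

Definition diag_lattice (c : 'I_n -> F) (o : 'I_n) (x y : F) (x0 : x != 0) :
  quad_lattice F n :=
  QuadLattice (etrans (dimvf _) (etrans (dim_matrix _ 1 n) (mul1n n))) (diag_form_quadratic c)
    (ex_intro _ (ideal_gens o x y) erefl) (ideal_gens_full o y x0).

(** At [p] the ideal of [x] and [y] is generated by [z] alone, so [z] times the vector of index [o],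
    with the other standard vectors, is a local basis. *)
Lemma detH_at_diag_lattice (p : prime_ideal F) (c : 'I_n -> F) (o : 'I_n)
    (x y z : F) (x0 : x != 0) d :
    (forall i, c i != 0) -> z = x \/ z = y -> z != 0 ->
    Oloc p (x / z) -> Oloc p (y / z) ->
  detH_at (diag_lattice c o y x0) p d <->
  exists2 u, Op_unit u & d = Fp_of p ((\prod_i c i) * z ^+ 2) * u ^+ 2.
Proof.
move=> c0 zxy z0 Oxz Oyz; pose k i := if i == o then z else 1.
have k0 i : k i != 0 by rewrite /k; case: ifP => // _; exact: oner_neq0.
pose v (i : 'I_n) : qspace (diag_lattice c o y x0) := k i *: delta_mx 0 i.
have gv : \det (gram (qform (diag_lattice c o y x0)) v) = (\prod_i c i) * z ^+ 2.
  rewrite /= gram_diag_form big_split /=; congr (_ * _).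
  rewrite (bigD1 o) //= big1 ?mulr1 => [|i /negPf io]; rewrite /k ?eqxx // io.
  by rewrite expr1n.
have bv : is_basis (@Op F p) (@loc_lattice F n (diag_lattice c o y x0) p)
    (fun i => loc_vec p (v i)).
  apply: (@loc_lattice_basis F n (diag_lattice c o y x0) p (ideal_gens o x y) v erefl).
  - move=> i; exists 1%N, (fun=> 1), (fun=> v i); split.
    + by move=> _; exact: (OF_nat F 1).
    + move=> _ /=; rewrite /v /k !inE; have [->|io] := eqVneq i o.
        by case: zxy => ->; rewrite eqxx ?orbT.
      by rewrite /= scale1r map_f ?orbT // mem_filter io mem_enum.
    + by rewrite big_ord1 scale1r.
  - have single i a : Oloc p a -> exists2 c' : 'I_n -> F, forall j, Oloc p (c' j) &
        a *: v i = \sum_j c' j *: v j.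
      move=> Oa; exists (fun j => if j == i then a else 0).
        by move=> j; case: ifP => // _; exact: Oloc0.
      by rewrite (bigD1 i) //= eqxx big1 ?addr0 // => j /negPf->; rewrite scale0r.
    have vo a : a *: delta_mx 0 o = (a / z) *: v o.
      by rewrite /v /k eqxx scalerA divfK.
    move=> w; rewrite !inE => /or3P[/eqP->|/eqP->|/mapP[i]].
    + by rewrite vo; exact: single.
    + by rewrite vo; exact: single.
    + rewrite mem_filter => /andP[/negPf io _] ->.
      rewrite (_ : delta_mx 0 i = 1 *: v i); first exact/single/Oloc1.
      by rewrite /v /k io !scale1r.
  - by rewrite gv mulf_neq0 ?expf_neq0 //; apply/prodf_neq0 => i _; exact: c0.
by rewrite (detH_at_basis _ bv) gram_loc_vec det_map_mx gv.
Qed.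

End DiagonalLattice.

(** * Passage between lattices and squareclasses *)

Theorem lemma2p10 (F : fieldExtType rat) (n : nat) (n_gt0 : (0 < n)%N)
    (S : SqCl F) :
  (exists L : quad_lattice F n, nondegenerate_form (qform L) /\ is_detH L S) <->
  globally_rational S.
Proof.
have [s SE] := sqcl_coset S; split=> [[L [nd LS]]|[a a0 aS]].
  have [a a0 aP] := detH_at_rational nd; exists a => // p d Sd.
  have [t tE] : exists t, d = Fp_of p a * t ^+ 2 by apply: aP; rewrite -LS.
  exists t => //=; move/(sqcl_atP _ SE): Sd => [u [Uu _ _] dE].
  (* Components of finite ideles are units, which forces [t] to be one. *)
  have : d \is a GRing.unit by rewrite dE unitrM idele_unit unitrX.
  by rewrite tE unitrM Fp_of_unit //= unitrX_pos.
(* [b p] is an element of [F] equal to the local factor [t] up to a unit, so [s p] is [a * b p ^+ 2]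
   up to the square of a unit. *)
have /choice[b bP] p : exists b : F, b != 0 /\
    exists2 w, Op_unit w & s p = Fp_of p (a * b ^+ 2) * w ^+ 2.
  have : sqcl_at S p (s p).
    by apply/(sqcl_atP _ SE); exists 1; [exact: Op_unit1|rewrite expr1n mulr1].
  case/aS => t Ut tE; have [b b0 Uw] := Fp_unit_approx Ut; exists b; split=> //.
  exists (t / Fp_of p b) => //.
  rewrite -tE rmorphM rmorphXn /= -mulrA -exprMn mulrC [_ * (t / _)]mulrC.
  by rewrite divrK ?Fp_of_unit // mulrC.
have b0 p : b p != 0 by case: (bP p).
have [x [y [x0 xyP]]] : exists x y, x != 0 /\ forall p, [/\ Oloc p (x / b p),
    Oloc p (y / b p) & Oloc_unit p (x / b p) \/ Oloc_unit p (y / b p)].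
  apply: idele_ideal_generators => //.
  (* Wherever [s p] and [a] are units, so is [b p ^+ 2], hence also [b p]. *)
  apply: (@sub_finite_set _ _ ([set p | ~ Op_unit (s p)] `|` [set p | ~ Oloc_unit p a])).
    move=> p /= nb; apply: contrapT => /not_orP[/contrapT Us /contrapT Ua]; apply: nb.
    have [_ [w Uw sE]] := bP p; apply: Oloc_unit_sqr; apply: Oloc_unit_of.
      by rewrite expf_neq0.
    have -> : Fp_of p (b p ^+ 2) = (Fp_of p a)^-1 * (s p * (w^-1 * w^-1)).
      have [Uw' _ _] := Uw.
      have ww : w ^+ 2 * (w^-1 * w^-1) = 1 by rewrite -expr2 -exprMn divrr ?expr1n.
      rewrite sE -[X in _ * X]mulrA ww mulr1 [in RHS]rmorphM /= mulKr //.
      exact: Fp_of_unit.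
    apply: Op_unitM; first exact/Op_unitV/Op_unit_of.
    by apply: Op_unitM => //; apply: Op_unitM; exact: Op_unitV.
  by rewrite finite_setU; split; [exact: idele_fin|exact: finite_nonunits].
(* Positivity of [n] provides the axis that carries both [a] and the ideal; in rank 0 every Hessian
   matrix is empty, with determinant 1. *)
pose o := Ordinal n_gt0; pose c (i : 'I_n) := if i == o then a else 1.
have c0 i : c i != 0 by rewrite /c; case: ifP => // _; exact: oner_neq0.
have prodc : \prod_i c i = a.
  by rewrite (bigD1 o) //= big1 ?mulr1 => [|i /negPf io]; rewrite /c ?eqxx ?io.
exists (diag_lattice c o y x0); split; first exact: diag_form_nondegenerate.
move=> p; have [Ox Oy xy] := xyP p.
have [z zxy Uz] : exists2 z, z = x \/ z = y & Oloc_unit p (z / b p).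
  by case: xy => ?; [exists x|exists y] => //; [left|right].
have [z0 [Oz OzV]] : z != 0 /\ Oloc p (z / b p) /\ Oloc p (b p / z).
  case: Uz => + ? OV; rewrite mulf_eq0 negb_or => /andP[z0 _]; split=> //; split=> //.
  by rewrite invfM invrK mulrC in OV.
have Oxz t : Oloc p (t / b p) -> Oloc p (t / z).
  move=> Ot; rewrite (_ : t / z = t / b p * (b p / z)); first exact: OlocM.
  by rewrite mulrA divfK ?b0.
have dP d := @detH_at_diag_lattice F n p c o x y z x0 d c0 zxy z0 (Oxz _ Ox) (Oxz _ Oy).
have [_ [w Uw sE]] := bP p.
have [Uw' _ _] := Uw; have Uzb := Op_unit_of Uz; have [Uzb' _ _] := Uzb.
(* [b p] is traded for [z], which differs from it by a unit at [p]. *)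
have sz : s p = Fp_of p (a * z ^+ 2) * (w / Fp_of p (z / b p)) ^+ 2.
  have -> : (Fp_of p (z / b p))^-1 = Fp_of p (b p / z) by rewrite -fmorphV invf_div.
  rewrite exprMn mulrCA -rmorphXn -rmorphM sE mulrC; congr (_ * Fp_of p _).
  by field; rewrite z0 ?b0.
have Uwz : Op_unit (w / Fp_of p (z / b p)) by apply: Op_unitM => //; exact: Op_unitV.
rewrite prodc in dP; apply/seteqP; split=> d.
  move/(sqcl_atP _ SE) => [u Uu dE]; apply/dP.
  exists (w / Fp_of p (z / b p) * u); first exact: Op_unitM.
  by rewrite dE sz; ring.
move/dP => [u Uu dE]; apply/(sqcl_atP _ SE).
exists ((w / Fp_of p (z / b p))^-1 * u); first by apply: Op_unitM => //; exact: Op_unitV.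
rewrite sz dE -mulrA -exprMn mulVKr //; first by case: Uwz.
Qed.
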